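(* Let $K$ be a field of characteristic zero. Let $c=(c_1,c_2,\dots)$ be a sequence of nonnegative integers and, for each $k\ge1$, let $\mathcal{C}_k$ be a finite set with $\#\mathcal{C}_k=c_k$. Let $F(t)=\exp\bigl(\sum_{k\ge1}c_k\,t^k/k!\bigr)$, let $(R_0,R_1,\dots)$ be the sprout sequence over $K$ with seed $F$, let $b_k:=c_k/(k-1)!$ for $k\ge1$ (so that $\log F(t)=\sum_{k\ge1}b_kt^k/k$), and let $\mathbf{R}_n:=\phi_b(S_n)$, where $\phi_b$ is the algebra endomorphism of $\mathbf{NSym}$ with $\phi_b(\Psi_k)=b_k\Psi_k$ for all $k\ge1$. Let $\alpha=(\alpha_1,\dots,\alpha_\ell)$ be a composition of $n$ with partial sums $s_j=\alpha_1+\dots+\alpha_j$. Then the number of $c$-structures on $[n]$ with max-ordered type $\alpha$ equals $$\prod_{j=1}^{\ell}\binom{s_j-1}{\alpha_j-1}\,c_{\alpha_j}=n!\,\prod_{j=1}^{\ell}\frac{b_{\alpha_j}}{s_j}=n!\,[\Psi^\alpha]\,\mathbf{R}_n .$$ Consequently, $$n!\,\mathbf{R}_n=\sum_{\alpha\vDash n}\#\{c\text{-structures on }[n]\text{ of max-ordered type }\alpha\}\,\Psi^\alpha,$$ and applying $\chi$ yields that, for every partition $\lambda$ of $n$, $n!\,[p_\lambda]R_n$ is the number of $c$-structures on $[n]$ whose multiset of block sizes is $\lambda$.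
   Context: $[n]=\{1,\dots,n\}$. A composition of $n$ (written $\alpha\vDash n$) is a finite sequence of positive integers with sum $n$. A $c$-structure on a finite set $X$ is a pair $(\pi,\gamma)$ where $\pi$ is a set partition of $X$ and $\gamma$ assigns to each block $B\in\pi$ an element $\gamma(B)\in\mathcal{C}_{\#B}$. Given a $c$-structure $(\pi,\gamma)$ on $[n]$ with $\ell$ blocks, list the blocks uniquely as $B_1,\dots,B_\ell$ with $\max B_1<\dots<\max B_\ell$; its max-ordered type is the composition $(\#B_1,\dots,\#B_\ell)$ of $n$. $\Lambda_K$ is the $K$-algebra of symmetric functions in $x=(x_1,x_2,\dots)$, with complete homogeneous symmetric functions $h_n$ and power sum basis $p_\lambda$; $[p_\lambda]f$ is the coefficient of $p_\lambda$ in $f$. The sprout sequence $(R_0,R_1,\dots)$ with seed a power series $F(t)\in K[[t]]$ with constant term $1$ is defined by $\sum_{n\ge0}R_nt^n=\prod_{i\ge1}F(x_it)$. $\mathbf{NSym}=K\langle S_1,S_2,\dots\rangle$ is the free associative $K$-algebra on noncommuting generators $S_k$ of degree $k$, with $S_0:=1$. The noncommutative power sums of the first kind $\Psi_k$ ($k\ge1$) are defined recursively by $nS_n=\sum_{k=1}^{n}S_{n-k}\Psi_k$ for $n\ge1$. For a composition $\alpha=(\alpha_1,\dots,\alpha_\ell)$ put $\Psi^\alpha:=\Psi_{\alpha_1}\cdots\Psi_{\alpha_\ell}$ (empty product $1$). The $\Psi_k$ freely generate $\mathbf{NSym}$, so $\phi_b$ exists and is unique, and $\{\Psi^\alpha:\alpha\vDash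 n\}$ is a basis of the degree-$n$ component; $[\Psi^\alpha]G$ is the coefficient of $\Psi^\alpha$ in $G$. $\chi:\mathbf{NSym}\to\Lambda_K$ is the $K$-algebra homomorphism with $\chi(S_n)=h_n$ for all $n\ge1$. *)

(* Defs.v *)
From HB Require Import structures.
From mathcomp Require Import all_boot all_algebra finmap boolp.
From mathcomp.multinomials Require Import monalg.

Set Implicit Arguments.
Unset Strict Implicit.
Unset Printing Implicit Defensive.

Import GRing.Theory.

Local Open Scope fset_scope.
Local Open Scope ring_scope.

Local Notation "1" := (@mone _) : monom_scope.
Local Notation "x * y" := (mmul x y) : monom_scope.

Section Compositions.
Local Open Scope nat_scope.

Definition composition : Type := {s : seq nat | 0 \notin s}.
HB.instance Definition _ := Choice.on composition.

Definition intpart : Type := {s : seq nat | (0 \notin s) && sorted geq s}.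
HB.instance Definition _ := Choice.on intpart.

Definition composition_seq (a : composition) : seq nat := val a.
Coercion composition_seq : composition >-> seq.
Definition intpart_seq (l : intpart) : seq nat := val l.
Coercion intpart_seq : intpart >-> seq.

Definition compositions (n : nat) : seq composition :=
  pmap insub [seq s <- [seq map (@nat_of_ord n.+1) (bseqval bs)
                       | bs : {bseq n of 'I_n.+1} <- enum predT] | sumn s == n].

Lemma size_le_sumn (s : seq nat) : 0 \notin s -> size s <= sumn s.
Proof.
elim: s => //= x s IHs; rewrite inE negb_or eq_sym -lt0n => /andP[x0 /IHs].
by move=> h; rewrite -add1n leq_add.
Qed.

Lemma compositions_uniq n : uniq (compositions n).
Proof.
apply/(pmap_uniq (@insubK _ _ _))/filter_uniq.
rewrite map_inj_uniq ?enum_uniq // => s t.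
by move/(inj_map (@ord_inj _))/val_inj.
Qed.

Lemma mem_compositions n (a : composition) :
  (a \in compositions n) = (sumn a == n).
Proof.
rewrite mem_pmap_sub mem_filter; case: eqP => //= <-.
have le_a i : i \in (a : seq nat) -> i < (sumn a).+1.
  rewrite /= ltnS; elim: (a : seq nat) => //= x s IHs; rewrite inE.
  by case/predU1P=> [->|/IHs/leq_trans->//]; rewrite ?leq_addr ?leq_addl.
pose t := [seq (inord i : 'I_(sumn a).+1) | i <- (a : seq nat)].
have tE : map (@nat_of_ord _) t = a.
  rewrite -map_comp -[RHS]map_id; apply/eq_in_map => i /le_a.
  exact: inordK.
have szt : size t <= sumn a by rewrite size_map size_le_sumn ?(valP a).
by apply/mapP; exists (Bseq szt); rewrite ?mem_enum.
Qed.

End Compositions.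

(* A block of size k carries an element of C k; the values of C at 0 are
   never used, blocks being nonempty. *)
Section CStructures.
Variables (C : nat -> finType) (T : finType).

Definition set_partition : Type :=
  {P : {set {set T}} | partition P [set: T]}.
HB.instance Definition _ := Finite.on set_partition.

Definition cstructure : Type :=
  {P : set_partition &
    {dffun forall B : {B : {set T} | B \in val P}, C #|val B|}}.
HB.instance Definition _ := Finite.on cstructure.

Definition blocks (g : cstructure) : {set {set T}} := val (tag g).

Definition block_sizes (g : cstructure) : seq nat :=
  [seq #|B : {set T}| | B <- enum (blocks g)].

End CStructures.

(* [n] is represented by 'I_n, i.e. shifted to {0, ..., n - 1}; this does not
   affect the relative order of the maxima. *)
Section MaxOrderedType.
Variables (C : nat -> finType) (n : nat).

Definition block_max (B : {set 'I_n}) : nat := \max_(i in B) (i : nat).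

Definition max_ordered_type (g : cstructure C 'I_n) : seq nat :=
  [seq #|B : {set 'I_n}|
  | B <- sort (relpre block_max leq) (enum (blocks g))].

Definition num_max_ordered (a : seq nat) : nat :=
  #|[set g : cstructure C 'I_n | max_ordered_type g == a]|.

Definition num_block_sizes (l : seq nat) : nat :=
  #|[set g : cstructure C 'I_n | perm_eq (block_sizes g) l]|.

End MaxOrderedType.

(* Formal power series in the variables x_0, x_1, ... given by their
   coefficients; monomials are finitely supported exponent vectors. *)
Record mseries (R : Type) := MSeries { mseries_coef :> {cmonom nat} -> R }.

HB.instance Definition _ (R : Type) := [isNew for @mseries_coef R].
HB.instance Definition _ (R : choiceType) := [Choice of mseries R by <:].

Section Divisors.
Implicit Types (m a b : {cmonom nat}).

Definition divs m : {fset {cmonom nat}} :=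
  [fset a in [seq [cmonom (f i : nat) | i : finsupp m]%M
             | f : {ffun finsupp m -> 'I_(mdeg m).+1} <- enum predT]
  | all (fun i => a i <= m i)%N (finsupp a)].

Lemma divsP m a : reflect (forall i, (a i <= m i)%N) (a \in divs m).
Proof.
apply: (iffP idP).
  rewrite !inE /= => /andP[_ /allP h] i.
  have [/h //|] := boolP (i \in finsupp a).
  by rewrite -cmE_eq0 => /eqP->.
move=> h; rewrite !inE /=; apply/andP; split; last by apply/allP.
have lt_a (i : finsupp m) : (a (val i) < (mdeg m).+1)%N.
  rewrite ltnS (leq_trans (h _)) // mdegE (big_fsetD1 (val i)) ?(valP i) //=.
  exact: leq_addr.
apply/mapP; exists [ffun i => Ordinal (lt_a i)]; rewrite ?mem_enum //.
apply/eqP/cmP => i; rewrite cmE /= fsfun_ffun.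
case: insubP => [u _ <-|] /=; first by rewrite ffunE.
by rewrite -cmE_eq0 => /eqP mi0; have := h i; rewrite mi0 leqn0 => /eqP.
Qed.

Lemma divs_mulr a b : a \in divs (a * b)%M.
Proof. by apply/divsP => i; rewrite cmM leq_addr. Qed.

Lemma divs_mull a b : b \in divs (a * b)%M.
Proof. by rewrite mulmC divs_mulr. Qed.

Lemma mul_divcm m a : a \in divs m -> (a * divcm m a)%M = m.
Proof.
by move/divsP=> h; apply/eqP/cmP => i; rewrite cmM divcmE subnKC.
Qed.

Lemma mulcmK a b : divcm (a * b)%M a = b.
Proof. by apply/eqP/cmP => i; rewrite divcmE cmM addKn. Qed.

Lemma divs_trans m a : a \in divs m -> {subset divs a <= divs m}.
Proof.
by move=> /divsP h b /divsP h'; apply/divsP => i; apply: leq_trans (h i).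
Qed.

Lemma big_divs (V : nmodType) m (D : {fset {cmonom nat}})
    (G : {cmonom nat} -> {cmonom nat} -> V) : {subset divs m <= D} ->
  \sum_(a <- divs m) G a (divcm m a) =
  \sum_(a <- D) \sum_(b <- D) G a b *+ (a * b == m)%M.
Proof.
move=> sD.
transitivity (\sum_(a <- D | a \in divs m) G a (divcm m a)).
  rewrite -[RHS]big_filter; apply: perm_big; apply: uniq_perm.
  - exact: fset_uniq.
  - by rewrite filter_uniq ?fset_uniq.
  by move=> a; rewrite mem_filter; case: (boolP (a \in divs m)) => // /sD->.
rewrite big_mkcond /=; apply: eq_bigr => a _; case: ifPn => am.
  have mb : divcm m a \in D by rewrite sD // -[X in divs X](mul_divcm am) divs_mull.
  rewrite (bigD1_seq (divcm m a)) ?fset_uniq //= mul_divcm // eqxx mulr1n.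
  rewrite big1 ?addr0 // => b neq_b; case: eqP => // def_m.
  by rewrite -def_m mulcmK eqxx in neq_b.
rewrite big1 // => b _; case: eqP => // def_m.
by rewrite -def_m divs_mulr in am.
Qed.

(* The exponent vector m \o s, where t is the inverse of s. *)
Definition cmrelabel (s t : nat -> nat) m : {cmonom nat} :=
  [cmonom m (s i) | i in [fset t j | j in finsupp m]]%M.

Lemma cmrelabelE s t m i : cancel s t -> cmrelabel s t m i = m (s i).
Proof.
move=> sK; rewrite cmE /= fsfunE; case: ifPn => // /imfsetP ni.
apply/esym/eqP; rewrite cmE_eq0; apply/negP => si; apply: ni.
by exists (s i) => //=; rewrite sK.
Qed.

Lemma finsupp_cmrelabel s t m : cancel s t -> cancel t s ->
  finsupp (cmrelabel s t m) = [fset t j | j in finsupp m].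
Proof.
move=> sK tK; apply/fsetP => i; rewrite -cmE_neq0 cmrelabelE // cmE_neq0.
apply/idP/imfsetP => [si|[j /= jm ->]]; last by rewrite tK.
by exists (s i) => //=; rewrite sK.
Qed.

Lemma mdeg_cmrelabel s t m : cancel s t -> cancel t s ->
  mdeg (cmrelabel s t m) = mdeg m.
Proof.
move=> sK tK; rewrite !mdegE finsupp_cmrelabel //.
rewrite big_imfset /=; last by move=> i j _ _; exact: can_inj.
by apply: eq_bigr => i _; rewrite cmrelabelE // tK.
Qed.

End Divisors.

Section MSeriesZmod.
Variable R : zmodType.
Implicit Types f g h : mseries R.

Lemma mseriesP f g : f =1 g <-> f = g.
Proof. by split=> [|-> //]; case: f g => f [g] /= /funext->. Qed.

Definition mseries_zero : mseries R := MSeries (fun=> 0).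
Definition mseries_opp f := MSeries (fun m => - f m).
Definition mseries_add f g := MSeries (fun m => f m + g m).

Fact mseries_addA : associative mseries_add.
Proof. by move=> f g h; apply/mseriesP => m /=; rewrite addrA. Qed.
Fact mseries_addC : commutative mseries_add.
Proof. by move=> f g; apply/mseriesP => m /=; rewrite addrC. Qed.
Fact mseries_add0 : left_id mseries_zero mseries_add.
Proof. by move=> f; apply/mseriesP => m /=; rewrite add0r. Qed.
Fact mseries_addN : left_inverse mseries_zero mseries_opp mseries_add.
Proof. by move=> f; apply/mseriesP => m /=; rewrite addNr. Qed.

HB.instance Definition _ := GRing.isZmodule.Build (mseries R)
  mseries_addA mseries_addC mseries_add0 mseries_addN.

Lemma mseries0E m : (0 : mseries R) m = 0. Proof. by []. Qed.
Lemma mseriesDE f g m : (f + g) m = f m + g m. Proof. by []. Qed.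
Lemma mseriesNE f m : (- f) m = - f m. Proof. by []. Qed.



End MSeriesZmod.

Section MSeriesRing.
Variable R : comNzRingType.
Implicit Types f g h : mseries R.

Definition mseries_one : mseries R := MSeries (fun m => (m == 1%M)%:R).
Definition mseries_mul f g : mseries R :=
  MSeries (fun m => \sum_(a <- divs m) f a * g (divcm m a)).
Definition mseries_scale (c : R) f := MSeries (fun m => c * f m).

Lemma mseries_mulE f g m (D : {fset {cmonom nat}}) : {subset divs m <= D} ->
  mseries_mul f g m =
  \sum_(a <- D) \sum_(b <- D) (f a * g b) *+ (a * b == m)%M.
Proof. by move=> sD; rewrite /= -(big_divs (fun a b => f a * g b)). Qed.

Fact mseries_mulC : commutative mseries_mul.
Proof.
move=> f g; apply/mseriesP => m; rewrite !(@mseries_mulE _ _ _ (divs m)) //.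
rewrite exchange_big /=; apply: eq_bigr => a _; apply: eq_bigr => b _.
by rewrite mulrC mulmC.
Qed.

Lemma mseries_mul3E f g h m (D : {fset {cmonom nat}}) : D = divs m ->
  mseries_mul f (mseries_mul g h) m =
  \sum_(a <- D) \sum_(b <- D) \sum_(c <- D)
     (f a * (g b * h c)) *+ (a * (b * c) == m)%M.
Proof.
move=> ->; rewrite (@mseries_mulE _ _ _ (divs m)) //; apply: eq_bigr => a _.
transitivity (\sum_(u <- divs m) \sum_(b <- divs m) \sum_(c <- divs m)
     (f a * (g b * h c)) *+ ((a * u == m) && (b * c == u))%M).
  apply: eq_big_seq => u /divs_trans su; rewrite (mseries_mulE _ _ su).
  rewrite mulr_sumr -sumrMnl; apply: eq_bigr => b _.
  rewrite mulr_sumr -sumrMnl; apply: eq_bigr => c _.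
  by rewrite mulrnAr -mulrnA mulnb andbC.
rewrite exchange_big; apply: eq_bigr => b _.
rewrite exchange_big; apply: eq_bigr => c _ /=.
have [def_m|neq_m] := eqVneq (a * (b * c))%M m; last first.
  apply: big1 => u _; case: eqP => //= def_m; case: eqP => // def_u.
  by rewrite -def_m -def_u eqxx in neq_m.
have bcm : (b * c)%M \in divs m by rewrite -def_m divs_mull.
rewrite (bigD1_seq (b * c)%M) ?fset_uniq //= def_m !eqxx big1 ?addr0 // => u.
by rewrite eq_sym => /negPf->; rewrite andbF.
Qed.

Fact mseries_mulA : associative mseries_mul.
Proof.
move=> f g h; rewrite [RHS]mseries_mulC; apply/mseriesP => m.
rewrite !(@mseries_mul3E _ _ _ _ (divs m)) //.
rewrite [RHS]exchange_big; apply: eq_bigr => a _ /=.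
rewrite [RHS]exchange_big; apply: eq_bigr => b _ /=.
apply: eq_bigr => c _; rewrite [(c * _)%M]mulmC -mulmA.
by rewrite [h c * _]mulrC mulrA.
Qed.

Fact mseries_mul1 : left_id mseries_one mseries_mul.
Proof.
move=> f; apply/mseriesP => m /=.
have d1 : (1%M : {cmonom nat}) \in divs m.
  by rewrite -[m]mul1m divs_mulr.
rewrite (bigD1_seq 1%M) ?fset_uniq //= eqxx mul1r big1 ?addr0.
  by congr (f _); apply/eqP/cmP => i; rewrite divcmE cm1 subn0.
by move=> a /negPf->; rewrite mul0r.
Qed.

Fact mseries_mulDl : left_distributive mseries_mul +%R.
Proof.
move=> f g h; apply/mseriesP => m; rewrite /= -big_split /=.
by apply: eq_bigr => a _; rewrite mulrDl.
Qed.

Fact mseries_one_neq0 : mseries_one != 0.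
Proof.
apply/eqP => /mseriesP/(_ 1%M); rewrite /= eqxx => /eqP.
by rewrite oner_eq0.
Qed.

HB.instance Definition _ := GRing.Zmodule_isComNzRing.Build (mseries R)
  mseries_mulA mseries_mulC mseries_mul1 mseries_mulDl mseries_one_neq0.

Fact mseries_scaleA a b f :
  mseries_scale a (mseries_scale b f) = mseries_scale (a * b) f.
Proof. by apply/mseriesP => m /=; rewrite mulrA. Qed.
Fact mseries_scale1 : left_id 1 mseries_scale.
Proof. by move=> f; apply/mseriesP => m /=; rewrite mul1r. Qed.
Fact mseries_scaleDr : right_distributive mseries_scale +%R.
Proof. by move=> a f g; apply/mseriesP => m; rewrite /= mulrDr. Qed.
Fact mseries_scaleDl f : {morph mseries_scale^~ f : a b / a + b}.
Proof. by move=> a b; apply/mseriesP => m; rewrite /= mulrDl. Qed.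

HB.instance Definition _ := GRing.Zmodule_isLmodule.Build R (mseries R)
  mseries_scaleA mseries_scale1 mseries_scaleDr mseries_scaleDl.

Fact mseries_scaleAl (a : R) f g : a *: (f * g) = (a *: f) * g.
Proof.
apply/mseriesP => m /=; rewrite mulr_sumr.
by apply: eq_bigr => b _; rewrite mulrA.
Qed.

HB.instance Definition _ :=
  GRing.Lmodule_isLalgebra.Build R (mseries R) mseries_scaleAl.
HB.instance Definition _ :=
  GRing.Lalgebra_isComAlgebra.Build R (mseries R).

Lemma mseries1E m : (1 : mseries R) m = (m == 1%M)%:R. Proof. by []. Qed.
Lemma mseriesME f g m :
  (f * g) m = \sum_(a <- divs m) f a * g (divcm m a).
Proof. by []. Qed.
Lemma mseriesZE (a : R) f m : (a *: f) m = a * f m. Proof. by []. Qed.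

Definition mvar (i : nat) : mseries R :=
  MSeries (fun m => (m == ucm i)%:R).

Definition mseries_symmetric f : Prop :=
  forall (s : nat -> nat) (m m' : {cmonom nat}),
    bijective s -> (forall i, m' i = m (s i)) -> f m' = f m.

Definition mseries_bounded f : Prop :=
  exists d : nat, forall m : {cmonom nat}, (d < mdeg m)%N -> f m = 0.

Definition symfun_pred : {pred mseries R} :=
  fun f => `[< mseries_symmetric f /\ mseries_bounded f >].

Lemma mseries_symmetricP f :
  (forall (s t : nat -> nat) (m : {cmonom nat}),
     cancel s t -> cancel t s -> f (cmrelabel s t m) = f m) <->
  mseries_symmetric f.
Proof.
split=> [h s m m' [t sK tK] def_m'|h s t m sK tK].
  rewrite -(h s t m) //; congr (f _).
  by apply/eqP/cmP => i; rewrite cmrelabelE.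
by apply: (h s); [exists t | move=> i; rewrite cmrelabelE].
Qed.

Lemma mseries_symmetricM f g :
  mseries_symmetric f -> mseries_symmetric g -> mseries_symmetric (f * g).
Proof.
move=> /mseries_symmetricP sf /mseries_symmetricP sg.
apply/mseries_symmetricP => s t m sK tK; rewrite !mseriesME.
have injr : injective (cmrelabel s t).
  move=> a b /eqP/cmP eq_ab; apply/eqP/cmP => i.
  by have := eq_ab (t i); rewrite !cmrelabelE // tK.
rewrite (perm_big [seq cmrelabel s t a | a <- divs m]) /=.
  rewrite big_map; apply: eq_bigr => a _; rewrite sf //; congr (_ * _).
  rewrite -[g (divcm m a)](sg s t) //; congr (g _); apply/eqP/cmP => i.
  by rewrite !(divcmE, cmrelabelE).
apply: uniq_perm; rewrite ?(map_inj_uniq injr) ?fset_uniq // => a.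
apply/divsP/mapP => [am|[b /divsP bm -> i]]; last by rewrite !cmrelabelE.
exists (cmrelabel t s a).
  by apply/divsP => i; rewrite cmrelabelE //; have := am (t i);
     rewrite cmrelabelE // tK.
by apply/eqP/cmP => i; rewrite !cmrelabelE // sK.
Qed.

Lemma mseries_boundedM f g :
  mseries_bounded f -> mseries_bounded g -> mseries_bounded (f * g).
Proof.
move=> [d df] [e eg]; exists (d + e)%N => m lt_m; rewrite mseriesME.
rewrite big_seq big1 // => a /mul_divcm def_m.
have [le_a|/df->] := leqP (mdeg a) d; last by rewrite mul0r.
rewrite eg ?mulr0 // -(ltn_add2l (mdeg a)) -mdegM def_m.
by rewrite (leq_ltn_trans _ lt_m) // leq_add2r.
Qed.

Fact symfun_subalg_closed : GRing.subalg_closed symfun_pred.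
Proof.
split=> [|a f g|f g].
- apply/asboolP; split; last first.
    exists 0%N => m; rewrite mseries1E; case: eqP => // ->.
    by rewrite mdeg1.
  apply/mseries_symmetricP => s t m sK tK.
  by rewrite !mseries1E -!mdeg_eq0 mdeg_cmrelabel.
- move=> /asboolP[sf [d df]] /asboolP[sg [e eg]]; apply/asboolP; split.
    move=> s m m' bs def_m'; rewrite !mseriesDE !mseriesZE.
    by rewrite (sf s m) // (sg s m).
  exists (maxn d e) => m; rewrite gtn_max => /andP[/df fm /eg gm].
  by rewrite mseriesDE mseriesZE fm gm mulr0 addr0.
move=> /asboolP[sf df] /asboolP[sg dg]; apply/asboolP; split.
  exact: mseries_symmetricM.
exact: mseries_boundedM.
Qed.

End MSeriesRing.

Arguments mvar R i : clear implicits.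

Record symfun (R : comNzRingType) := SymFun {
  symfun_series :> mseries R;
  _ : symfun_series \in @symfun_pred R
}.

Section SymFun.
Variable R : comNzRingType.

HB.instance Definition _ := [isSub for @symfun_series R].
HB.instance Definition _ := [Choice of symfun R by <:].
HB.instance Definition _ :=
  GRing.SubChoice_isSubComNzRing.Build (mseries R) (@symfun_pred R) (symfun R)
    (GRing.subalg_closedBM (@symfun_subalg_closed R)).
HB.instance Definition _ :=
  GRing.SubZmodule_isSubLmodule.Build R (mseries R) (@symfun_pred R) (symfun R)
    (GRing.subsemialg_closedZ (GRing.subalg_closed_semi (@symfun_subalg_closed R))).
HB.instance Definition _ :=
  GRing.SubNzRing_SubLmodule_isSubLalgebra.Build R (mseries R)
    (@symfun_pred R) (symfun R).
HB.instance Definition _ := GRing.Lalgebra_isComAlgebra.Build R (symfun R).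

Fact hsym_subproof n :
  MSeries (fun m => (mdeg m == n)%:R) \in @symfun_pred R.
Proof.
apply/asboolP; split; last first.
  by exists n => m /=; case: eqP => // <-; rewrite ltnn.
by apply/mseries_symmetricP => s t m sK tK /=; rewrite mdeg_cmrelabel.
Qed.

Definition hsym n : symfun R := SymFun (hsym_subproof n).

(* For k >= 1 the monomials of degree k supported on a single variable are
   exactly the x_i ^ k. *)
Fact psym_subproof k :
  MSeries (fun m => ((mdeg m == k) && (#|` finsupp m| == 1%N))%:R)
    \in @symfun_pred R.
Proof.
apply/asboolP; split; last first.
  by exists k => m /=; case: eqP => // <-; rewrite ltnn.
apply/mseries_symmetricP => s t m sK tK /=; rewrite mdeg_cmrelabel //.
by rewrite finsupp_cmrelabel // card_imfset //=; apply: can_inj tK.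
Qed.

Definition psym k : symfun R := SymFun (psym_subproof k).

Definition psym_part (l : intpart) : symfun R := \prod_(k <- l) psym k.

(* Sum_n Q_n t^n = Prod_i F(x_i t). The coefficient of t^n in a finite product
   only depends on the factors modulo t^(n+1), and the infinite product is the
   coefficientwise limit of the finite ones. *)
Definition sprout_sequence (F : nat -> R) (Q : nat -> symfun R) : Prop :=
  forall (n : nat) (m : {cmonom nat}), exists N0 : nat, forall N : nat,
    (N0 <= N)%N ->
    Q n m = ((\prod_(i < N) \poly_(k < n.+1) (F k *: mvar R i ^+ k))`_n) m.

End SymFun.

Section Seed.
Variable K : fieldType.

(* Coefficients of exp (G t), for a power series G without constant term:
   G ^ j has no terms of degree < j. *)
Definition fps_exp (G : nat -> K) (n : nat) : K :=
  \sum_(j < n.+1) ((\poly_(k < n.+1) G k) ^+ j)`_n / (j`!)%:R.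

Definition seed (c : nat -> nat) : nat -> K :=
  fps_exp (fun k => if k is 0%N then 0 else (c k)%:R / (k`!)%:R).

Definition bcoef (c : nat -> nat) (k : nat) : K := (c k)%:R / (k.-1`!)%:R.

End Seed.

(* The letter i stands for the generator S_(i+1). *)
Notation nsym K := {malg K[{fmonom nat}]}.

Section NSym.
Variable K : fieldType.

Definition Sgen (n : nat) : nsym K :=
  if n is i.+1 then << fmu i >> else 1.

(* [:: Psi_1; ...; Psi_n] *)
Fixpoint Psi_list (n : nat) : seq (nsym K) :=
  if n is i.+1 then
    rcons (Psi_list i)
      (n%:R *: Sgen n - \sum_(1 <= k < n) Sgen (n - k) * (Psi_list i)`_k.-1)
  else [::].

Definition Psi (k : nat) : nsym K := (Psi_list k)`_k.-1.

Lemma size_Psi_list n : size (Psi_list n) = n.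
Proof. by elim: n => //= n IHn; rewrite size_rcons IHn. Qed.

Lemma nth_Psi_list n k : (0 < k <= n)%N -> (Psi_list n)`_k.-1 = Psi k.
Proof.
elim: n => [|n IHn] /andP[k0]; first by rewrite leqNgt k0.
rewrite leq_eqVlt => /predU1P[-> //|]; rewrite ltnS => kn.
by rewrite [Psi_list _.+1]/= nth_rcons size_Psi_list prednK // kn IHn ?k0.
Qed.

Lemma Psi_rec n : (0 < n)%N ->
  n%:R *: Sgen n = \sum_(1 <= k < n.+1) Sgen (n - k) * Psi k.
Proof.
case: n => // n _; rewrite big_nat_recr //= subnn mul1r.
rewrite [X in _ + X]/Psi /= nth_rcons size_Psi_list ltnn eqxx.
rewrite [X in _ + (_ - X)](_ : _ =
    \sum_(1 <= k < n.+1) Sgen (n.+1 - k) * Psi k) ?subrKC //.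
by apply: eq_big_nat => k; rewrite ltnS => /nth_Psi_list->.
Qed.

Definition Psi_comp (a : composition) : nsym K := \prod_(k <- a) Psi k.

End NSym.

(* The family of coefficients of x in a linearly independent family v; it is 0
   when x is not in the span of v. *)
Section BasisCoefficients.
Variables (K : fieldType) (I : choiceType) (V : lmodType K) (v : I -> V).

Definition lincomb (a : {malg K[I]}) : V := \sum_(i <- msupp a) a@_i *: v i.

Definition basis_coefs (x : V) : {malg K[I]} :=
  if pselect (exists a, lincomb a = x) is left ex then sval (cid ex) else 0.

Definition basis_coef (i : I) (x : V) : K := (basis_coefs x)@_i.

End BasisCoefficients.

(* Main.v *)
From HB Require Import structures.
Require Import Defs.
From mathcomp Require Import all_boot all_algebra finmap boolp ring.
From mathcomp.multinomials Require Import monalg.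

(** The count goes by removing the last block of a structure. In the max-order
    the last block is the one that contains the largest point, so its other
    points form an arbitrary subset of the remaining ones: for a block of size
    k in a set of size s this gives 'C(s - 1, k - 1) choices, times c_k for the
    decoration, and what is left is an arbitrary structure on the complement
    ([card_partitions_of_type], [num_max_orderedE]). Since
    'C(s - 1, k - 1) c_k = (s! / (s - k)!) b_k / s, the product telescopes to
    n! times the product of the b_(a_j) / s_j ([struct_count_weight]).

    All the algebra rests on one recursion: y_0 = 1 and
    n y_n = sum_k y_(n-k) u_k. In characteristic zero it determines y from u,
    it determines u from y, and its solution is the sum over the compositions
    a of n of u_(a_1) ... u_(a_l) / (s_1 ... s_l) ([newton_comp_sum]). The
    generators S_n satisfy it with u = Psi by definition, which gives the
    expansion of S_n, hence of phi S_n, in the products of the Psi_k. The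
    coefficients of that expansion can be read off because these products are
    linearly independent: the substitution S_n |-> sum of S^a / (s_1 ... s_l)
    sends Psi_k to S_k, as both families solve the same recursion, hence sends
    Psi^a to a single word ([Psi_comp_indep]).

    On the commutative side the coefficient of x^m in the n-th term of a
    sprout sequence is the product of the F(m_i) when m has degree n, and
    t F' = F (sum_k b_k t^k) turns into the same recursion for R with
    u_k = b_k p_k ([newton_sprout]). The constant seed F_n = 1, b_k = 1, gives
    Newton's identities between the h_n and the p_k, so that chi Psi_k = p_k,
    and then chi (phi S_n) = R_n by uniqueness ([chi_phi_Sgen]). Finally
    chi Psi^a is the power sum of the partition obtained by sorting a, so the
    compositions with the same sorting add up; the power sums p_l are linearly
    independent because p_l only involves monomials whose exponents are
    obtained by merging parts of l ([psym_part_indep]). *)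

Set Implicit Arguments.
Unset Strict Implicit.
Unset Printing Implicit Defensive.

Import GRing.Theory.
Local Open Scope ring_scope.

(** * Counting structures by max-ordered type *)

Section CompositionBasics.
Local Open Scope nat_scope.

Definition Composition (s : seq nat) (s0 : 0 \notin s) : composition :=
  exist _ s s0.

Lemma composition_gt0 (a : composition) k : k \in (a : seq nat) -> 0 < k.
Proof.
case: a => a a0; rewrite /composition_seq lt0n /= => ka.
by apply: contraNneq a0 => <-.
Qed.

Lemma big_partial_sums_rcons (R : Type) (idx : R) (op : Monoid.law idx)
    (H : nat -> nat -> R) (a : seq nat) k :
  \big[op/idx]_(j < size (rcons a k))
     H (sumn (take j.+1 (rcons a k))) (nth 0 (rcons a k) j) =
  op (\big[op/idx]_(j < size a) H (sumn (take j.+1 a)) (nth 0 a j))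
     (H (sumn a + k) k).
Proof.
rewrite size_rcons big_ord_recr /= take_oversize ?size_rcons // sumn_rcons.
rewrite nth_rcons ltnn eqxx; congr (op _ _); apply: eq_bigr => j _.
by rewrite nth_rcons ltn_ord -cats1 takel_cat ?ltn_ord.
Qed.

End CompositionBasics.

Section CountingStructures.
Local Open Scope nat_scope.
Variables (C : nat -> finType) (T : finType).

(** The number of decorations depends on the partition only, so a property of
    the blocks is counted by a weighted sum over partitions. *)
Lemma card_cstructure (f : pred {set {set T}}) :
  #|[set g : cstructure C T | f (blocks g)]| =
  \sum_(P : {set {set T}} | partition P [set: T] && f P)
    \prod_(B in P) #|C #|B| |.
Proof.
rewrite -sum1dep_card.
transitivity (\sum_(p : cstructure C T | f (val (tag p)) && xpredT (tagged p)) 1).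
  by apply: eq_bigl => g; rewrite andbT.
rewrite -(sig_big_dep (fun P : set_partition T => f (val P))
  (fun P => xpredT) (fun P _ => 1)).
rewrite [RHS](big_sub_cond (fun P => partition P [set: T]) f) /=.
apply: eq_bigr => P fP.
rewrite sum1_card card_dep_ffun foldrE big_map big_enum /=.
by rewrite -(big_sub (fun B => B \in val P) (fun B => #|C #|B| |)).
Qed.

End CountingStructures.

Section MaxType.
Local Open Scope nat_scope.
Variable n : nat.
Implicit Types (P Q : {set {set 'I_n}}) (D B : {set 'I_n}).

Definition max_type P : seq nat :=
  [seq #|B : {set 'I_n}| | B <- sort (relpre (@block_max n) leq) (enum P)].

Lemma sumn_max_type P D : partition P D -> sumn (max_type P) = #|D|.
Proof.
move=> pP; rewrite (card_partition pP) sumnE big_map -big_enum /=.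
by apply: perm_big; rewrite perm_sort.
Qed.

Lemma notin0_max_type P D : partition P D -> 0 \notin max_type P.
Proof.
move=> pP; apply/negP => /mapP[B]; rewrite mem_sort mem_enum => BP /esym/eqP.
by rewrite cards_eq0 (negPf (partition_neq0 pP BP)).
Qed.

Lemma leq_block_max B (i : 'I_n) : i \in B -> i <= block_max B.
Proof. exact: (@leq_bigmax_cond _ _ (fun i : 'I_n => i : nat)). Qed.

Lemma block_max_mem B : B != set0 -> exists2 i : 'I_n, i \in B & block_max B = i.
Proof.
rewrite -card_gt0 => /(eq_bigmax_cond (fun i : 'I_n => i : nat))[i iB e].
by exists i.
Qed.

(** Disjoint nonempty blocks have distinct maxima, so that sorting by maxima
    has only one possible result. *)
Lemma block_max_inj P D : partition P D -> {in P &, injective (@block_max n)}.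
Proof.
move=> pP A B AP BP eqAB.
have [i iA mA] := block_max_mem (partition_neq0 pP AP).
have [j jB mB] := block_max_mem (partition_neq0 pP BP).
have ij : i = j by apply/ord_inj; rewrite -mA -mB.
have /and3P[_ tiP _] := pP.
by rewrite -(def_pblock tiP AP iA) ij (def_pblock tiP BP jB).
Qed.

(** Lets the last part of the type be split off: the block with the largest
    maximum comes last. *)
Lemma max_type_setU1 P D B : partition P D ->
  (forall A, A \in P -> block_max A < block_max B) ->
  max_type (B |: P) = rcons (max_type P) #|B|.
Proof.
move=> pP ltB; rewrite /max_type -map_rcons; congr map.
have BnP : B \notin P by apply/negP => /ltB; rewrite ltnn.
have inj : {in B |: P &, injective (@block_max n)}.
  move=> A A'; rewrite !in_setU1.
  move=> /predU1P[->|AP] /predU1P[->|A'P] //; last exact: (block_max_inj pP).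
    by move=> e; have := ltB _ A'P; rewrite e ltnn.
  by move=> e; have := ltB _ AP; rewrite e ltnn.
apply: (@sorted_eq_in _ (relpre (@block_max n) leq)).
- by move=> ? ? ? _ _ _ /=; apply: leq_trans.
- move=> A A'; rewrite !mem_sort !mem_enum => AP A'P /= /anti_leq.
  exact: inj.
- by apply: sort_sorted => ? ?; apply: leq_total.
- have : sorted (relpre (@block_max n) leq)
           (sort (relpre (@block_max n) leq) (enum P)).
    by apply: sort_sorted => ? ?; apply: leq_total.
  have : all (fun A => block_max A <= block_max B)
           (sort (relpre (@block_max n) leq) (enum P)).
    by apply/allP => A; rewrite mem_sort mem_enum => /ltB/ltnW.
  case: (sort _ _) => //= A s /andP[leA les] ps.
  rewrite rcons_path ps /=; have [->//|ns] := eqVneq s [::].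
  by have /allP := les; apply; case: s ns {les ps} => //= u s _; apply: mem_last.
rewrite perm_sort perm_sym perm_rcons.
apply: uniq_perm; rewrite ?enum_uniq //=.
  by rewrite mem_sort mem_enum BnP sort_uniq enum_uniq.
by move=> A; rewrite inE mem_sort !mem_enum in_setU1.
Qed.

Lemma card_pointed_subsets D (x : 'I_n) k : x \in D -> 0 < k ->
  #|[set B : {set 'I_n} | [&& B \subset D, x \in B & #|B| == k]]| =
  'C(#|D|.-1, k.-1).
Proof.
move=> xD k0.
have xDx : x \notin D :\ x by rewrite !inE eqxx.
have -> : #|D|.-1 = #|D :\ x| by rewrite (cardsD1 x D) xD.
rewrite -cards_draws.
have inj : {in [set A : {set 'I_n} | (A \subset D :\ x) && (#|A| == k.-1)] &,
             injective (fun A => x |: A)}.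
  move=> A A'; rewrite !inE => /andP[/subsetP sA _] /andP[/subsetP sA' _] e.
  have xA : x \notin A by apply: contra xDx => /sA.
  have xA' : x \notin A' by apply: contra xDx => /sA'.
  by rewrite -(setU1K xA) e setU1K.
rewrite -(card_in_imset inj); apply: eq_card => B; rewrite inE.
apply/and3P/imsetP => [[sB xB /eqP cB]|[A]].
  exists (B :\ x); last by rewrite setD1K.
  by rewrite inE setSD //= -cB (cardsD1 x B) xB.
rewrite inE => /andP[sA /eqP cA] ->.
have xA : x \notin A by apply: contra xDx => /(subsetP sA).
split; first by rewrite subUset sub1set xD (subset_trans sA) ?subsetDl.
  by rewrite setU11.
by rewrite cardsU1 xA cA add1n prednK.
Qed.

Definition partitions_of_type D (a : seq nat) : {set {set {set 'I_n}}} :=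
  [set P : {set {set 'I_n}} | partition P D && (max_type P == a)].

Lemma mem_partitions_of_type D a P :
  (P \in partitions_of_type D a) = partition P D && (max_type P == a).
Proof. by rewrite inE. Qed.

(** Once the block B of the largest point x is fixed, partitions of D are
    partitions of the complement of B, and their type only loses the part #|B|. *)
Lemma partitions_of_typeU1 D B (x : 'I_n) a k : B \subset D -> x \in B ->
  (forall i, i \in D -> i <= x) -> #|B| = k ->
  [set P in partitions_of_type D (rcons a k) | pblock P x == B] =
  (fun Q => B |: Q) @: partitions_of_type (D :\: B) a.
Proof.
move=> sB xB maxx cB.
have mB : block_max B = x.
  apply/eqP; rewrite eqn_leq leq_block_max // andbT.
  by apply/bigmax_leqP => i /(subsetP sB)/maxx.
have typeU1 Q : partition Q (D :\: B) ->
    max_type (B |: Q) = rcons (max_type Q) #|B|.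
  move=> pQ; apply: (max_type_setU1 pQ) => A AQ; rewrite mB.
  have [i iA ->] := block_max_mem (partition_neq0 pQ AQ).
  have : i \in D :\: B by rewrite -(cover_partition pQ); apply/bigcupP; exists A.
  rewrite inE => /andP[iB /maxx]; rewrite leq_eqVlt => /predU1P[/ord_inj e|//].
  by rewrite e xB in iB.
apply/setP => P; apply/idP/imsetP => [|[Q]].
  rewrite !inE => /andP[/andP[pP tP] /eqP bP].
  have xc : x \in cover P by rewrite (cover_partition pP) (subsetP sB).
  have BP : B \in P by rewrite -bP pblock_mem.
  exists (P :\ B); last by rewrite setD1K.
  rewrite inE (partitionD1 pP BP) /=.
  move: tP; rewrite -{1}(setD1K BP) typeU1 ?(partitionD1 pP) //.
  by rewrite eqseq_rcons => /andP[].
rewrite mem_partitions_of_type => /andP[pQ /eqP tQ] ->; rewrite !inE.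
have pU : partition (B |: Q) D.
  rewrite -[D](setID D B) (setIidPr sB).
  rewrite partitionU1 //; first by apply/set0Pn; exists x.
  by rewrite disjoint_sym; apply/setDidPl; rewrite setDDl setUid.
rewrite pU typeU1 // tQ cB eqxx /=.
have /and3P[_ tiU _] := pU.
by apply/eqP; apply: def_pblock => //; rewrite setU11.
Qed.

(** Induction on the last part: classify by the block of the largest point,
    whose other k - 1 points are arbitrary. *)
Lemma card_partitions_of_type D a : 0 \notin a -> sumn a = #|D| ->
  #|partitions_of_type D a| =
  \prod_(j < size a) 'C((sumn (take j.+1 a)).-1, (nth 0 a j).-1).
Proof.
elim/last_ind: a D => [|a k IHa] D.
  move=> _ /= /esym/eqP; rewrite cards_eq0 => /eqP->; rewrite big_ord0.
  rewrite -(cards1 (set0 : {set {set 'I_n}})); apply: eq_card => P.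
  rewrite !inE partition_set0; case: eqP => //= ->.
  by rewrite /max_type enum_set0.
rewrite mem_rcons inE negb_or eq_sym -lt0n => /andP[k0 a0].
rewrite sumn_rcons => cD.
have /card_gt0P[x0 x0D] : 0 < #|D| by rewrite -cD addn_gt0 k0 orbT.
case: (arg_maxnP (fun i : 'I_n => i : nat) x0D) => x /= xD maxx.
rewrite (big_partial_sums_rcons _ (fun s i => 'C(s.-1, i.-1))) /=.
rewrite -sum1_card (partition_big (fun P => pblock P x)
  (fun B => B \in [set B : {set 'I_n} | [&& B \subset D, x \in B & #|B| == k]])) /=.
  rewrite (eq_bigr (fun=> \prod_(j < size a)
     'C((sumn (take j.+1 a)).-1, (nth 0 a j).-1))).
    by rewrite sum_nat_const card_pointed_subsets // cD mulnC.
  move=> B; rewrite inE => /and3P[sB xB /eqP cB].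
  rewrite -(IHa (D :\: B)) //; last first.
    by rewrite cardsD (setIidPr sB) cB -cD addnK.
  rewrite -(card_in_imset (f := fun Q => B |: Q)).
    rewrite -(partitions_of_typeU1 a sB xB maxx cB).
    by rewrite -sum1dep_card.
  move=> Q Q'; rewrite !inE => /andP[pQ _] /andP[pQ' _] e.
  have BnQ R : partition R (D :\: B) -> B \notin R.
    move=> pR; apply/negP => BR.
    have : x \in D :\: B by rewrite -(cover_partition pR); apply/bigcupP; exists B.
    by rewrite inE xB.
  by rewrite -(setU1K (BnQ _ pQ)) e setU1K ?BnQ.
move=> P; rewrite !inE => /andP[pP /eqP tP].
have xc : x \in cover P by rewrite (cover_partition pP).
(* The type of P ends with the size of the block of its largest point x. *)
set B := pblock P x.
have BP : B \in P by rewrite pblock_mem.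
have xB : x \in B by rewrite mem_pblock.
have sB : B \subset D.
  by rewrite -(cover_partition pP); apply: (@bigcup_sup _ _ B _ id).
have : P \in (fun Q => B |: Q) @: partitions_of_type (D :\: B) (max_type (P :\ B)).
  apply/imsetP; exists (P :\ B); last by rewrite setD1K.
  by rewrite mem_partitions_of_type (partitionD1 pP BP) eqxx.
rewrite -(partitions_of_typeU1 _ sB xB maxx erefl) !inE tP eqseq_rcons sB xB.
by case/andP=> /and3P[_ _ /eqP->] _; rewrite eqxx.
Qed.

End MaxType.

Section CountingByType.
Local Open Scope nat_scope.
Variables (c : nat -> nat) (C : nat -> finType) (n : nat).
Hypothesis cardC : forall k, 0 < k -> #|C k| = c k.

(** The decorations contribute the product of the c_k over the block sizes,
    which are the entries of the type. *)
Lemma num_max_orderedE a : 0 \notin a -> sumn a = n ->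
  num_max_ordered C n a =
  \prod_(j < size a)
     ('C((sumn (take j.+1 a)).-1, (nth 0 a j).-1) * c (nth 0 a j)).
Proof.
move=> a0 sa; rewrite big_split /=.
rewrite -(@card_partitions_of_type n setT) ?cardsT ?card_ord //.
rewrite -sum1_card big_distrl /= /num_max_ordered.
rewrite (@card_cstructure C _ (fun P => max_type P == a)).
apply: eq_big => P; first by rewrite inE.
case/andP=> pP /eqP <-; rewrite mul1n.
rewrite -(big_mkord xpredT (fun j => c (nth 0 (max_type P) j))).
rewrite -(big_nth 0 xpredT c) big_map.
rewrite [RHS](perm_big (enum P)) ?perm_sort //= big_enum /=.
by apply: eq_bigr => B BP; rewrite cardC // card_gt0 (partition_neq0 pP).
Qed.

(** The max-ordered type lists the block sizes, so it is one of the
    rearrangements of l. *)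
Lemma num_block_sizesE l : sumn l = n ->
  num_block_sizes C n l =
  \sum_(a <- compositions n | perm_eq a l) num_max_ordered C n a.
Proof.
move=> sl; rewrite /num_block_sizes -sum1_card.
have typeP (g : cstructure C 'I_n) : partition (blocks g) setT := valP (tag g).
pose ty g : composition :=
  @Composition (max_ordered_type g) (notin0_max_type (typeP g)).
have perm_ty g : perm_eq (ty g) (block_sizes g).
  by rewrite perm_map // perm_sort.
rewrite big_mkcond /=.
transitivity (\sum_(a <- compositions n | perm_eq a l)
                \sum_(g : cstructure C 'I_n | ty g == a) 1); last first.
  apply: eq_bigr => a _; rewrite /num_max_ordered -sum1dep_card.
  by apply: eq_bigl => g; rewrite -val_eqE.
rewrite (exchange_big_dep xpredT) //=; apply: eq_bigr => g _.
have tyin : ty g \in compositions n.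
  by rewrite mem_compositions (sumn_max_type (typeP g)) cardsT card_ord.
rewrite big_mkcondl /= -big_filter.
rewrite (perm_big [:: ty g]) ?big_seq1 ?inE.
  by rewrite -(permPl (perm_ty g)).
apply: uniq_perm => [||a]; rewrite ?filter_uniq ?compositions_uniq //.
rewrite mem_filter inE [RHS]eq_sym; case: eqP => //= <-.
exact: tyin.
Qed.

End CountingByType.

(** * Coefficients in a basis, compositions and Newton's recursion *)

Section BasisCoefficient.
Variables (K : fieldType) (I : choiceType) (V : lmodType K) (v : I -> V).

Definition lin_independent := forall a : {malg K[I]}, lincomb v a = 0 -> a = 0.

Lemma lincombEw (d : {fset I}) (a : {malg K[I]}) : (msupp a `<=` d)%fset ->
  lincomb v a = \sum_(i <- d) a@_i *: v i.
Proof.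
move=> le; rewrite [LHS](big_fset_incl _ le) // => i _ /mcoeff_outdom->.
by rewrite scale0r.
Qed.

Lemma lincombB : {morph lincomb v : a b / a - b}.
Proof.
move=> a b; pose d := (msupp a `|` msupp b)%fset.
rewrite (lincombEw (msuppB_le a b)).
rewrite (@lincombEw d a) ?fsubsetUl // (@lincombEw d b) ?fsubsetUr //.
by rewrite -sumrB; apply: eq_bigr => i _; rewrite mcoeffB scalerBl.
Qed.

HB.instance Definition _ :=
  GRing.isAdditive.Build {malg K[I]} V (lincomb v) lincombB.

Lemma lincombU x i : lincomb v << x *g i >> = x *: v i.
Proof. by rewrite (lincombEw msuppU_le) big_seq_fset1 mcoeffUU. Qed.

(** Repeated vectors, f j = f j', are allowed: this is what collects all the
    compositions that sort to one partition. *)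
Lemma basis_coef_sum (J : Type) (s : seq J) (w : J -> K) (f : J -> I) i :
  lin_independent ->
  basis_coef v i (\sum_(j <- s) w j *: v (f j)) =
  \sum_(j <- s) w j *+ (f j == i).
Proof.
move=> indep; pose a := \sum_(j <- s) << w j *g f j >>.
have ax : lincomb v a = \sum_(j <- s) w j *: v (f j).
  by rewrite raddf_sum; apply: eq_bigr => j _; apply: lincombU.
rewrite /basis_coef /basis_coefs; case: pselect => [ex|[]]; last by exists a.
case: (cid ex) => b /= bx.
have -> : b = a by apply/subr0_eq/indep; rewrite raddfB /= bx ax subrr.
by rewrite raddf_sum; apply: eq_bigr => j _; apply: mcoeffU.
Qed.

End BasisCoefficient.

Section Compositions.

(** Compositions are classified by their last part k, as in the recursion
    n S_n = sum_k S_(n-k) Psi_k. *)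
Lemma big_compositions_rcons (V : nmodType) (F : seq nat -> V) n : (0 < n)%N ->
  \sum_(a <- compositions n) F a =
  \sum_(1 <= k < n.+1) \sum_(a <- compositions (n - k)) F (rcons a k).
Proof.
move=> n0; rewrite -(big_map val xpredT F) /index_iota subn1 /=.
rewrite -(big_allpairs_dep (h := fun k (a : composition) => rcons a k)
            (r2 := fun k => compositions (n - k)) (F := F)).
apply: perm_big; apply: uniq_perm.
- by rewrite (map_inj_uniq val_inj) compositions_uniq.
- apply: allpairs_uniq_dep; rewrite ?iota_uniq //.
    by move=> k _; apply: compositions_uniq.
  by move=> [k a] [k' a'] /= _ _ /rcons_inj[/val_inj -> ->].
move=> s; apply/mapP/allpairsPdep => [[[a a0] + ->]|[k [a [+ + ->]]]].
  rewrite mem_compositions /composition_seq; case/lastP: a a0 => [|b k] b0 /=.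
    by rewrite eq_sym (gtn_eqF n0).
  rewrite sumn_rcons => /eqP <-.
  move: b0; rewrite mem_rcons inE negb_or eq_sym -lt0n => /andP[k0 b0].
  exists k, (Composition b0); split=> //.
    by rewrite mem_iota k0 add1n ltnS leq_addl.
  by rewrite mem_compositions addnK.
rewrite mem_iota add1n ltnS => /andP[k0 kn].
rewrite mem_compositions => /eqP sa.
have ak0 : 0%N \notin rcons (composition_seq a) k.
  by rewrite mem_rcons inE negb_or eq_sym -lt0n k0 (valP a).
exists (Composition ak0) => //; rewrite mem_compositions /= sumn_rcons sa.
by rewrite subnK.
Qed.

Lemma big_compositions0 (V : nmodType) (F : seq nat -> V) :
  \sum_(a <- compositions 0) F a = F [::].
Proof.
pose nilc := @Composition [::] isT.
rewrite (perm_big [:: nilc]) ?big_seq1 //.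
apply: uniq_perm => [||[a a0]] //; first exact: compositions_uniq.
rewrite mem_compositions inE -val_eqE /composition_seq /=.
case: a a0 => //= x s; rewrite inE negb_or => /andP[x0 _].
by rewrite addn_eq0 eq_sym (negPf x0).
Qed.

End Compositions.

Section Newton.
Variables (K : fieldType).
Hypothesis char0 : [pchar K] =i pred0.

Lemma char0_natr_neq0 n : (0 < n)%N -> n%:R != 0 :> K.
Proof. by move: char0 => /pcharf0P e; rewrite e lt0n. Qed.

Variable A : lalgType K.
Implicit Types y u : nat -> A.

(** The differential equation t Y' = Y U for the series Y and U with
    coefficients y_n and u_k; the order of the factors matters, the
    algebra being noncommutative. *)
Definition newton y u := forall n, (0 < n)%N ->
  n%:R *: y n = \sum_(1 <= k < n.+1) y (n - k)%N * u k.

Lemma newton_uniq y y' u :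
  y 0%N = y' 0%N -> newton y u -> newton y' u -> y =1 y'.
Proof.
move=> y0 yu y'u n; elim/ltn_ind: n => -[//|n] IHn.
apply: (scalerI (char0_natr_neq0 (ltn0Sn n))); rewrite yu // y'u //.
apply: eq_big_nat => k /andP[k0 _]; congr (_ * _); apply: IHn.
by rewrite ltn_subrL k0.
Qed.

(** The term k = n of the sum is u_n, since y_0 = 1; all the others are known
    by induction. *)
Lemma newton_inj y u u' : y 0%N = 1 -> newton y u -> newton y u' ->
  forall k, (0 < k)%N -> u k = u' k.
Proof.
move=> y0 yu yu' k; elim/ltn_ind: k => -[//|n] IHn _.
have e := yu _ (ltn0Sn n); rewrite (yu' _ (ltn0Sn n)) in e.
rewrite [LHS]big_nat_recr //= [RHS]big_nat_recr //= subnn y0 !mul1r in e.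
apply/esym; move: e; rewrite [X in X + _ = _](_ : _ =
    \sum_(1 <= i < n.+1) y (n.+1 - i)%N * u i) => [/addrI//|].
by apply: eq_big_nat => i /andP[i0 lt_i]; rewrite IHn.
Qed.

Definition comp_weight (a : seq nat) : K :=
  \prod_(j < size a) ((sumn (take j.+1 a))%:R)^-1.

Lemma comp_weight_rcons a k :
  comp_weight (rcons a k) = comp_weight a / (sumn a + k)%:R.
Proof.
exact: (big_partial_sums_rcons _ (fun s _ => (s%:R)^-1)).
Qed.

Definition comp_sum u n : A :=
  \sum_(a <- compositions n) comp_weight a *: \prod_(k <- (a : seq nat)) u k.

Lemma comp_sum0 u : comp_sum u 0 = 1.
Proof.
rewrite /comp_sum (big_compositions0
  (fun a => comp_weight a *: \prod_(k <- a) u k)).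
by rewrite /comp_weight big_ord0 big_nil scale1r.
Qed.

(** Splitting off the last part of a composition of n removes the partial sum
    s_l = n from the denominator, which cancels the factor n. *)
Lemma newton_comp_sum u : newton (comp_sum u) u.
Proof.
move=> n n0; rewrite /comp_sum (big_compositions_rcons
  (fun a => comp_weight a *: \prod_(k <- a) u k)) // scaler_sumr.
apply: eq_big_nat => k /andP[k0]; rewrite ltnS => kn.
rewrite scaler_sumr mulr_suml; apply: eq_big_seq => a.
rewrite mem_compositions => /eqP sa.
rewrite comp_weight_rcons sa subnK // big_rcons /= scalerA.
by rewrite mulrCA divff ?mulr1 ?char0_natr_neq0 // scalerAl.
Qed.

End Newton.

(** * Sprout sequences and exponential seeds *)

Section Monomials.
Implicit Types m : {cmonom nat}.

(** The exponent vector of x_i ^ k. *)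
Definition powcm (i k : nat) : {cmonom nat} := [cmonom k | _ in [fset i]%fset]%M.

Lemma powcmE i k j : powcm i k j = if j == i then k else 0%N.
Proof. by rewrite cmE /= fsfunE in_fset1. Qed.

Lemma powcm_in_divs i k m : (powcm i k \in divs m) = (k <= m i)%N.
Proof.
apply/divsP/idP => [/(_ i)|ki j]; first by rewrite powcmE eqxx.
by rewrite powcmE; case: eqP => // ->.
Qed.

Lemma finsupp_powcm i k : (0 < k)%N -> finsupp (powcm i k) = [fset i]%fset.
Proof.
move=> k0; apply/fsetP => j; rewrite -cmE_neq0 powcmE in_fset1.
by case: (j == i); rewrite // -lt0n k0.
Qed.

Lemma mdeg_powcm i k : mdeg (powcm i k) = k.
Proof.
rewrite (mdegEw (d := [fset i]%fset)) ?big_seq_fset1 ?powcmE ?eqxx //.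
apply/fsubsetP => j; rewrite -cmE_neq0 powcmE in_fset1.
by case: (j == i).
Qed.

Lemma powcmP m k : (0 < k)%N ->
  reflect (exists i, m = powcm i k) ((mdeg m == k) && (#|` finsupp m| == 1%N)).
Proof.
move=> k0; apply: (iffP andP) => [[/eqP dm /cardfs1P[i si]]|[i ->]].
  exists i; apply/eqP/cmP => j; rewrite powcmE; case: eqP => [->|/eqP ji].
    by rewrite -dm mdegE si big_seq_fset1.
  by apply/eqP; rewrite cmE_eq0 si in_fset1.
by rewrite mdeg_powcm finsupp_powcm // cardfs1.
Qed.

Lemma divcm_powcmE m i k j :
  divcm m (powcm i k) j = (m j - (if j == i then k else 0))%N.
Proof. by rewrite divcmE powcmE. Qed.

Lemma mdeg_divcm_powcm m i k : (k <= m i)%N ->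
  mdeg m = (mdeg (divcm m (powcm i k)) + k)%N.
Proof.
move=> ki; rewrite -[in LHS](@mul_divcm m (powcm i k)) ?powcm_in_divs //.
by rewrite mdegM mdeg_powcm addnC.
Qed.

Lemma leq_mdeg m i : (m i <= mdeg m)%N.
Proof. by rewrite (mdeg_divcm_powcm (leqnn (m i))) leq_addl. Qed.

End Monomials.

Section Products.
Variable R : comNzRingType.
Implicit Types (m : {cmonom nat}) (f g : symfun R).

Lemma mseries_sumE (J : Type) (s : seq J) (G : J -> mseries R) m :
  (\sum_(i <- s) G i) m = \sum_(i <- s) G i m.
Proof. by elim/big_rec2: _ => [|i x y _ <-]. Qed.

Lemma symfun_sumE (J : Type) (s : seq J) (G : J -> symfun R) m :
  (\sum_(i <- s) G i) m = \sum_(i <- s) G i m.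
Proof. by elim/big_rec2: _ => [|i x y _ <-]. Qed.

Lemma mseries_mul_monomial (f : mseries R) (u m : {cmonom nat}) :
  (f * MSeries (fun a => (a == u)%:R)) m =
  if u \in divs m then f (divcm m u) else 0.
Proof.
rewrite mulrC mseriesME; case: ifPn => um.
  rewrite (bigD1_seq u) ?fset_uniq //= eqxx mul1r big1 ?addr0 // => a.
  by move=> /negPf->; rewrite mul0r.
rewrite big_seq big1 // => a am /=.
by case: eqP am um => [->|_] => [->//|]; rewrite mul0r.
Qed.

Lemma mvarX i k :
  mvar R i ^+ k = MSeries (fun a => (a == powcm i k)%:R).
Proof.
elim: k => [|k IHk].
  rewrite expr0; apply/mseriesP => m /=; congr (_ == _)%:R.
  by apply/eqP/cmP => j; rewrite powcmE cm1; case: eqP.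
rewrite exprSr IHk; apply/mseriesP => m; rewrite mseries_mul_monomial /=.
rewrite (_ : ucm i = powcm i 1) // powcm_in_divs.
have [mi|mi] := leqP 1 (m i).
  congr (nat_of_bool _)%:R; apply/cmP/cmP => e j; have := e j.
    rewrite !powcmE divcm_powcmE; case: eqP => [->|_]; last by rewrite subn0.
    by rewrite subn1 => <-; rewrite prednK.
  rewrite !powcmE divcm_powcmE => ->; case: eqP => [//|_]; last by rewrite subn0.
  by rewrite subn1.
case: eqP => // e; move: mi; rewrite e powcmE eqxx.
by [].
Qed.

Lemma mseries_mul_mvarX (f : mseries R) i k m :
  (f * mvar R i ^+ k) m =
  if (k <= m i)%N then f (divcm m (powcm i k)) else 0.
Proof. by rewrite mvarX mseries_mul_monomial powcm_in_divs. Qed.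

(** The monomials x_i ^ k that divide x^m are indexed by the variables with
    exponent at least k; for k = 0 they would all be the monomial 1. *)
Lemma mulr_psymE f k m : (0 < k)%N ->
  (f * psym R k) m =
  \sum_(i <- finsupp m | (k <= m i)%N) f (divcm m (powcm i k)).
Proof.
move=> k0; rewrite [f * _]mulrC.
transitivity (\sum_(a <- divs m) psym R k a * f (divcm m a)); first by [].
transitivity (\sum_(a <- divs m |
    (mdeg a == k) && (#|` finsupp a| == 1%N)) f (divcm m a)).
  rewrite [RHS]big_mkcond /=; apply: eq_bigr => a _ /=.
  by case: ifP => _; rewrite ?mul1r ?mul0r.
rewrite -big_filter -[RHS]big_filter.
rewrite -(big_map (fun i => powcm i k) xpredT (fun a => f (divcm m a))).
apply: perm_big; apply: uniq_perm.
- by rewrite filter_uniq ?fset_uniq.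
- rewrite map_inj_in_uniq ?filter_uniq ?fset_uniq // => i j _ _ e.
  have := congr1 (fun u : {cmonom nat} => u j) e.
  rewrite /= !powcmE eqxx; case: eqP => // _ e0.
  by rewrite -e0 in k0.
move=> a; rewrite mem_filter; apply/andP/mapP => [[/(powcmP _ k0)[i ->] d]|].
  rewrite powcm_in_divs in d; exists i => //.
  by rewrite mem_filter d -cmE_neq0 -lt0n (leq_trans k0 d).
case=> i; rewrite mem_filter => /andP[ki _] ->.
by rewrite powcm_in_divs ki; split=> //; apply/(powcmP _ k0); exists i.
Qed.

End Products.

Section Sprouts.
Variables (K : fieldType) (F : nat -> K).
Hypothesis F0 : F 0%N = 1.
Implicit Types m : {cmonom nat}.
Local Notation "1" := (@mone _) : monom_scope.

(** Expanding the product of the F(x_i t): the coefficient of x^m takes F_(m_i)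
    from each factor, and t counts the degree. *)
Definition sprout_coef (n : nat) m : K :=
  (mdeg m == n)%:R * \prod_(i <- finsupp m) F (m i).

Lemma prod_finsuppw (s : seq nat) m : uniq s -> {subset finsupp m <= s} ->
  \prod_(i <- finsupp m) F (m i) = \prod_(i <- s) F (m i).
Proof.
move=> us ss; rewrite [RHS](bigID (fun i => i \in finsupp m)) /=.
rewrite [X in _ * X]big1 ?mulr1 => [|i]; last first.
  by rewrite -cmE_eq0 => /eqP->.
rewrite -[RHS]big_filter; apply: perm_big; apply: uniq_perm.
- exact: fset_uniq.
- by rewrite filter_uniq.
by move=> i; rewrite mem_filter; case: (boolP (i \in finsupp m)) => // /ss->.
Qed.

(** The last variable x_N occurs only in the last factor, so only the power
    x_N ^ (m N) of that factor contributes to x^m. *)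
Lemma coef_finite_sprout n N m j : (j <= n)%N ->
  ((\prod_(i < N) \poly_(k < n.+1) (F k *: mvar K i ^+ k))`_j) m =
  ((mdeg m == j) && all (fun i => i < N)%N (finsupp m))%:R *
  \prod_(i < N) F (m i).
Proof.
elim: N m j => [|N IHN] m j jn.
  rewrite !big_ord0 mulr1 coef1 /=.
  transitivity (((j == 0%N) && (m == 1%M))%:R : K).
    by case: eqP => _ //=; rewrite mseries1E.
  congr (nat_of_bool _)%:R; apply/andP/andP => [[/eqP-> /eqP->]|[/eqP dm]].
    by rewrite mdeg1 mdom1.
  have -> : all (fun i => i < 0)%N (finsupp m) = (finsupp m == fset0).
    by apply/allP/eqP => [h|->//]; apply/fsetP => i; apply/idP => /h.
  move=> /eqP sm; have e : mdeg m = 0%N by rewrite mdegE sm big_seq_fset0.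
  by rewrite -dm e -mdeg_eq0 e.
rewrite !big_ord_recr /= coefMr.
rewrite mseries_sumE.
have term (k : 'I_j.+1) :
    ((\prod_(i < N) \poly_(k < n.+1) (F k *: mvar K i ^+ k))`_(j - k) *
     (\poly_(k < n.+1) (F k *: mvar K N ^+ k))`_k) m =
    if k == m N :> nat then
      ((mdeg m == j) && all (fun i => i < N.+1)%N (finsupp m))%:R *
      \prod_(i < N) F (m i) * F (m N) else 0.
  have kj : (k <= j)%N by rewrite -ltnS.
  rewrite coef_poly ltnS (leq_trans kj jn) -scalerAr mseriesZE.
  rewrite mseries_mul_mvarX; set d := divcm m _.
  have [lt_mk|lt_km|kE] := ltngtP k (m N).
  (* If k < m N, the variable N still divides the quotient, and the first N
     factors do not involve it. *)
  - rewrite (IHN d) ?(leq_trans (leq_subr _ _)) //.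
    rewrite [all _ _](_ : _ = false) ?andbF ?mul0r ?mulr0 //.
    apply/negbTE/allPn; exists N; rewrite ?ltnn //.
    by rewrite -cmE_neq0 divcm_powcmE eqxx -lt0n subn_gt0.
  - by rewrite mulr0.
  rewrite (IHN d) ?(leq_trans (leq_subr _ _)) //.
  rewrite mulrC -kE; congr (_%:R * _ * _); last first.
    apply: eq_bigr => i _; rewrite divcm_powcmE.
    by rewrite (ltn_eqF (ltn_ord i)) subn0.
  congr (nat_of_bool (_ && _)).
    have km : (k <= m N)%N by rewrite kE.
    rewrite (mdeg_divcm_powcm km) -/d.
    by rewrite -(eqn_add2r k) subnK.
  apply/allP/allP => h i; rewrite -cmE_neq0; last first.
    rewrite divcm_powcmE; have [->|iN] := eqVneq i N; first by rewrite kE subnn.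
    by rewrite subn0 cmE_neq0 => /h; rewrite ltnS leq_eqVlt (negPf iN).
  move=> mi; rewrite ltnS leq_eqVlt; have [//|iN] := eqVneq i N; apply: h.
  by rewrite -cmE_neq0 divcm_powcmE (negPf iN) subn0.
rewrite (eq_bigr _ (fun k _ => term k)) -mulrA.
have [lt_mj|le_jm] := ltnP (m N) j.+1.
  rewrite (bigD1 (Ordinal lt_mj)) //= eqxx [X in _ + X]big1 ?addr0 ?mulrA // => k.
  by rewrite -val_eqE => /negPf->.
rewrite [LHS]big1 => [|k _]; last first.
  by case: eqP => // kE; have := ltn_ord k; rewrite kE ltnNge le_jm.
case: eqP => [dm|]; last by rewrite mul0r.
by have := leq_mdeg m N; rewrite dm leqNgt le_jm.
Qed.

(** The coefficient of x^m stabilises as soon as all the variables of m are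
    among the first N; the later factors contribute F_0 = 1. *)
Lemma sprout_sequence_coef (Q : nat -> symfun K) : sprout_sequence F Q ->
  forall n m, Q n m = sprout_coef n m.
Proof.
move=> FQ n m; have [N0 QE] := FQ n m.
pose N := (N0 + \sum_(i <- finsupp m) i.+1)%N.
have ltN i : i \in finsupp m -> (i < N)%N.
  move=> im; rewrite /N (bigD1_seq i) ?fset_uniq //=.
  by rewrite addnCA leq_addr.
rewrite (QE N) ?leq_addr // coef_finite_sprout // /sprout_coef.
rewrite (introT allP ltN) andbT; congr (_ * _).
rewrite (@prod_finsuppw (index_iota 0 N)) ?iota_uniq ?big_mkord // => i /ltN.
by rewrite mem_index_iota.
Qed.

(** Logarithmic differentiation, one variable at a time: the terms of the
    coefficient of x^m that lower the exponent of x_i add up, by the recursion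
    for F, to m_i times the product of the F(m_j), and the m_i sum to n. *)
Lemma newton_sprout (b : nat -> K) (Q : nat -> symfun K) :
  (forall n, (0 < n)%N ->
     n%:R * F n = \sum_(1 <= k < n.+1) F (n - k)%N * b k) ->
  (forall n m, Q n m = sprout_coef n m) ->
  newton Q (fun k => b k *: psym K k).
Proof.
move=> Fb QE n n0; apply/val_inj/mseriesP => m /=.
have valZ (x : K) (f : symfun K) : (x *: f) m = x * f m by [].
rewrite [LHS]valZ [RHS]symfun_sumE QE.
pose P i := \prod_(j <- finsupp m | j != i) F (m j).
have PE i x : i \in finsupp m -> (mdeg m == n) -> (x <= m i)%N ->
    Q (n - x)%N (divcm m (powcm i x)) = F (m i - x)%N * P i.
  move=> im dm xm; rewrite QE /sprout_coef.
  have dx := mdeg_divcm_powcm xm.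
  rewrite -(eqP dm) {1}dx addnK eqxx mul1r.
  rewrite (@prod_finsuppw (finsupp m)) ?fset_uniq //; last first.
    move=> j; rewrite -!cmE_neq0 divcm_powcmE; apply: contra_neq => ->.
    by rewrite sub0n.
  rewrite (bigD1_seq i) ?fset_uniq //= divcm_powcmE eqxx; congr (_ * _).
  by apply: eq_bigr => j /negPf ji; rewrite divcm_powcmE ji subn0.
transitivity (\sum_(1 <= k < n.+1) \sum_(i <- finsupp m | (k <= m i)%N)
    (F (m i - k)%N * b k * P i) *+ (mdeg m == n)); last first.
  apply: eq_big_nat => k /andP[k0 kn].
  rewrite -scalerAr valZ mulr_psymE // mulr_sumr.
  rewrite big_seq_cond [RHS]big_seq_cond; apply: eq_bigr => i /andP[im ki].
  case: (boolP (mdeg m == n)) => dm.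
    by rewrite PE // mulrCA mulrA mulr1n.
  rewrite QE /sprout_coef (_ : (_ == _) = false) ?mul0r ?mulr0 //.
  apply/negbTE; apply: contraNneq dm => e.
  by rewrite (mdeg_divcm_powcm ki) e subnK.
rewrite /sprout_coef; case: (boolP (mdeg m == n)) => dm; last first.
  by rewrite mul0r mulr0 big1 // => k _; rewrite big1.
rewrite mul1r (exchange_big_dep xpredT) //=.
(* Both sides are sums over the variables of m; P i is the product over the
   other variables. *)
transitivity (\sum_(i <- finsupp m) (m i)%:R * F (m i) * P i).
  rewrite -(eqP dm) mdegE natr_sum mulr_suml.
  apply: eq_big_seq => i im; rewrite -mulrA; congr (_ * _).
  by rewrite (bigD1_seq i) ?fset_uniq.
apply: eq_big_seq => i im.
have mi0 : (0 < m i)%N by rewrite lt0n cmE_neq0.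
rewrite Fb // mulr_suml; apply/esym.
have min : (m i <= n)%N by rewrite -(eqP dm) leq_mdeg.
rewrite (big_cat_nat _ (n := (m i).+1)) //=.
rewrite [X in _ + X]big_nat_cond [X in _ + X]big1 ?addr0; last first.
  by move=> k /andP[/andP[lt_k _]]; rewrite leqNgt lt_k.
rewrite big_nat_cond [RHS]big_nat; apply: eq_bigl => k.
by rewrite ltnS; case: (k <= m i)%N; rewrite ?andbF ?andbT.
Qed.

End Sprouts.

Section Exponential.
Variables (K : fieldType).
Hypothesis char0 : [pchar K] =i pred0.
Variable G : nat -> K.
Hypothesis G0 : G 0%N = 0.

Lemma fps_exp0 : fps_exp G 0 = 1.
Proof. by rewrite /fps_exp big_ord1 expr0 coef1 divr1. Qed.

(** Only the terms of G up to degree i matter, so the truncation may be changed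
    to a common one before polynomials are compared. *)
Lemma coef_truncX N M j i : (i <= N)%N -> (i <= M)%N ->
  ((\poly_(k < N.+1) G k) ^+ j)`_i = ((\poly_(k < M.+1) G k) ^+ j)`_i.
Proof.
elim: j i => [|j IHj] i iN iM; first by rewrite !expr0.
rewrite !exprS !coefM; apply: eq_bigr => k _.
have ki : (k <= i)%N by rewrite -ltnS.
rewrite !coef_poly !ltnS (leq_trans ki iN) (leq_trans ki iM) IHj //.
  by rewrite (leq_trans (leq_subr _ _)).
by rewrite (leq_trans (leq_subr _ _)).
Qed.

(** As G has no constant term, high powers do not contribute to low degrees,
    so the exponential sum may be extended. *)
Lemma coef_truncX_lt N j i : (i < j)%N ->
  ((\poly_(k < N.+1) G k) ^+ j)`_i = 0.
Proof.
elim: j i => // j IHj i ij; rewrite exprS coefM big1 // => -[[|k] ki] _ /=.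
  by rewrite coef_poly /= G0 mul0r.
rewrite IHj ?mulr0 // (leq_trans _ (ij : (i <= j)%N)) // ltn_subrL /=.
exact: leq_ltn_trans (ki : (k < i)%N).
Qed.

Lemma fps_exp_trunc N J n : (n <= N)%N -> (n <= J)%N ->
  fps_exp G n =
  (\sum_(j < J.+1) (j`!)%:R^-1 *: (\poly_(k < N.+1) G k) ^+ j)`_n.
Proof.
move=> nN nJ; rewrite coef_sum.
rewrite -(big_mkord xpredT (fun j => ((j`!)%:R^-1 *: (\poly_(k < N.+1) G k) ^+ j)`_n)).
rewrite (big_cat_nat _ (n := n.+1)) //= [X in _ + X]big_nat_cond.
rewrite [X in _ + X]big1 ?addr0 => [|j /andP[/andP[nj _] _]]; last first.
  by rewrite coefZ coef_truncX_lt ?mulr0.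
rewrite big_mkord; apply: eq_bigr => j _.
by rewrite coefZ mulrC (coef_truncX _ _ nN).
Qed.

(** The coefficients of E' = G' E for E = exp G, read off from truncations. *)
Lemma fps_exp_rec n : (0 < n)%N ->
  n%:R * fps_exp G n = \sum_(1 <= k < n.+1) fps_exp G (n - k) * (k%:R * G k).
Proof.
case: n => // n _; pose P := \poly_(k < n.+2) G k.
pose E J := \sum_(j < J.+1) (j`!)%:R^-1 *: P ^+ j.
have derivE : (E n.+1)^`() = P^`() * E n.
  rewrite /E big_ord_recl expr0 linearD linearZ /= derivC scaler0 add0r.
  rewrite linear_sum mulr_sumr /=; apply: eq_bigr => j _.
  rewrite linearZ /= deriv_exp /bump add1n /= -scaler_nat scalerA scalerAr.
  congr (_ * (_ *: _)); rewrite factS natrM invfM mulrAC mulVf ?mul1r //.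
  exact: (char0_natr_neq0 char0).
rewrite (@fps_exp_trunc n.+1 n.+1) // -/P -/(E n.+1).
have := congr1 (fun p : {poly K} => p`_n) derivE.
rewrite coef_deriv coefM mulr_natl => ->.
rewrite big_add1 big_mkord /=; apply: eq_bigr => k _.
have kn : (k <= n)%N by rewrite -ltnS.
rewrite coef_deriv coef_poly ltnS (leq_trans (ltn_ord k)) //.
rewrite subSS (@fps_exp_trunc n.+1 n) ?leq_subr //; last first.
  by rewrite (leq_trans (leq_subr _ _)).
by rewrite mulr_natl mulrC.
Qed.

End Exponential.

Section Seed.
Variables (K : fieldType).
Hypothesis char0 : [pchar K] =i pred0.
Variable c : nat -> nat.

Lemma seed0 : seed K c 0 = 1. Proof. exact: fps_exp0. Qed.

Lemma seed_rec n : (0 < n)%N ->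
  n%:R * seed K c n = \sum_(1 <= k < n.+1) seed K c (n - k) * bcoef K c k.
Proof.
move=> n0; rewrite /seed fps_exp_rec //; apply: eq_big_nat => -[//|k] _.
congr (_ * _); rewrite /bcoef factS natrM invfM mulrCA; congr (_ * _).
by rewrite mulrA divff ?mul1r // (char0_natr_neq0 char0).
Qed.

(** Newton's identities, as the case of the seed 1 / (1 - t). *)
Lemma newton_hsym : newton (hsym K) (psym K).
Proof.
move=> n n0; rewrite (@newton_sprout _ (fun=> 1) erefl (fun=> 1)) //.
- by apply: eq_bigr => k _; rewrite scale1r.
- by move=> m m0; rewrite mulr1 (eq_bigr _ (fun k _ => mulr1 1)) sumr_const_nat subn1.
by move=> k m; rewrite /sprout_coef big1 ?mulr1.
Qed.

End Seed.

(** * Linear independence of the power sums *)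

Section PowerSums.
Variable K : fieldType.
Hypothesis char0 : [pchar K] =i pred0.
Implicit Types (m : {cmonom nat}) (s : seq nat).

(** The number of maps f from the positions of s to the variables for which
    x^m is the product of the x_(f j) ^ s_j; a natural number, so that its
    vanishing can be decided without cancellation in K. *)
Fixpoint psum_count s m : nat :=
  if s is k :: s' then
    (\sum_(i <- finsupp m | k <= m i) psum_count s' (divcm m (powcm i k)))%N
  else (mdeg m == 0%N).

Lemma coef_prod_psym s m : 0%N \notin s ->
  (\prod_(k <- s) psym K k) m = (psum_count s m)%:R.
Proof.
elim: s m => [|k s IHs] m.
  by rewrite big_nil /= mdeg_eq0.
rewrite inE negb_or eq_sym -lt0n big_cons mulrC => /andP[k0 /IHs IH].
rewrite mulr_psymE //= natr_sum.
by apply: eq_bigr => i _; rewrite IH.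
Qed.

Definition exponents m : seq nat := [seq m i | i <- finsupp m].

Lemma finsupp_divcm_lt m i k : (k < m i)%N ->
  finsupp (divcm m (powcm i k)) = finsupp m.
Proof.
move=> ki; apply/fsetP => j; rewrite -!cmE_neq0 divcm_powcmE.
have [->|_] := eqVneq j i; last by rewrite subn0.
by rewrite -!lt0n subn_gt0 ki (leq_trans _ ki).
Qed.

Lemma finsupp_divcm_full m i :
  finsupp (divcm m (powcm i (m i))) = (finsupp m `\ i)%fset.
Proof.
apply/fsetP => j; rewrite in_fsetD1 -!cmE_neq0 divcm_powcmE.
by have [->|_] := eqVneq j i; rewrite ?subnn ?subn0.
Qed.

Lemma exponents_divcm m i : i \in finsupp m ->
  perm_eq (exponents m) (m i :: exponents (divcm m (powcm i (m i)))).
Proof.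
move=> im; rewrite /exponents finsupp_divcm_full.
have -> : [seq divcm m (powcm i (m i)) j | j <- (finsupp m `\ i)%fset] =
          [seq m j | j <- (finsupp m `\ i)%fset].
  apply/eq_in_map => j; rewrite in_fsetD1 => /andP[/negPf ji _].
  by rewrite divcm_powcmE ji subn0.
rewrite -(map_cons m i) perm_map //; apply: uniq_perm => [||j].
- exact: fset_uniq.
- by rewrite /= fset_uniq in_fsetD1 eqxx.
by rewrite inE in_fsetD1; have [->|] := eqVneq j i.
Qed.

(** The exponents of m are sums of the parts of s that are sent to the same
    variable, so there are at most as many, with equality only when no two
    parts are merged. *)
Lemma psum_count_coarser s m : 0%N \notin s -> (0 < psum_count s m)%N ->
  (size (exponents m) <= size s)%N /\
  (size (exponents m) = size s -> perm_eq (exponents m) s).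
Proof.
elim: s m => [|k s IHs] m /=.
  rewrite lt0b mdeg_eq0 => _ /eqP->.
  by rewrite (_ : exponents _ = [::]) //; apply/size0nil; rewrite size_map mdom1.
rewrite inE negb_or eq_sym -lt0n => /andP[k0 s0].
rewrite lt0n sum_nat_seq_neq0 => /hasP[i im].
rewrite -lt0n => /andP[+ /(IHs _ s0)[]]; rewrite leq_eqVlt.
case/predU1P=> [->|ki le_s eq_s].
  have := exponents_divcm im => pm le_s eq_s.
  rewrite (perm_size pm) /= ltnS; split=> // -[/eq_s ps].
  by rewrite (permPl pm) perm_cons.
have le_m : (size (exponents m) <= size s)%N.
  by move: le_s; rewrite !size_map finsupp_divcm_lt.
split; first exact: leqW.
by move=> e; rewrite e ltnn in le_m.
Qed.

Lemma psum_count_gt0 s m : perm_eq (exponents m) s -> (0 < psum_count s m)%N.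
Proof.
elim: s m => [|k s IHs] m /=.
  by move=> /perm_size/eqP; rewrite size_map cardfs_eq0 mdegE => /eqP->;
     rewrite big_seq_fset0.
move=> pm.
have /mapP[i im def_k] : k \in exponents m by rewrite (perm_mem pm) mem_head.
rewrite lt0n sum_nat_seq_neq0; apply/hasP; exists i => //.
rewrite def_k leqnn -lt0n IHs //.
by rewrite -(perm_cons (m i)) -(permPl (exponents_divcm im)) -def_k.
Qed.

Lemma exists_exponents s : 0%N \notin s -> exists m, perm_eq (exponents m) s.
Proof.
move=> s0.
pose m := [cmonom nth 0%N s i | i in [fset i in iota 0 (size s)]%fset]%M.
have mE i : m i = nth 0%N s i.
  rewrite cmE /= fsfunE !inE mem_iota /= add0n.
  by case: ltnP => // /(nth_default _)->.
exists m.
have supp_m : perm_eq (finsupp m) (iota 0 (size s)).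
  apply: uniq_perm; rewrite ?fset_uniq ?iota_uniq // => i.
  rewrite mem_iota /= add0n -cmE_neq0 mE.
  case: ltnP => [lt_i|/(nth_default _)->//].
  by apply: contraNneq s0 => <-; apply: mem_nth.
rewrite /exponents (perm_trans (perm_map _ supp_m)) //.
by rewrite (eq_map mE) -/(mkseq _ _) mkseq_nth.
Qed.

(** In a vanishing combination take l with the most parts and a monomial with
    exponents l: any other p_l' containing it would need more parts than l. *)
Lemma psym_part_indep : lin_independent (@psym_part K).
Proof.
move=> a a0; apply/malgP => l0; rewrite mcoeff0; apply/eqP.
rewrite mcoeff_eq0; apply/negP => l0a.
have l0P (l : intpart) : 0%N \notin (l : seq nat) by case/andP: (valP l).
have [l la maxl] : exists2 l, l \in msupp a &
    forall l', l' \in msupp a -> (size (l' : intpart) <= size (l : intpart))%N.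
  have := @arg_maxnP _ [` l0a]%fset xpredT (fun x : msupp a => size (val x : intpart)) isT.
  case=> x _ maxx; exists (val x); first exact: valP.
  by move=> l' l'a; apply: (maxx [` l'a]%fset).
have [m pm] := exists_exponents (l0P l).
have : lincomb (@psym_part K) a m = 0 by rewrite a0.
rewrite symfun_sumE (bigD1_seq l) ?fset_uniq //= big1_seq ?addr0.
  rewrite coef_prod_psym // => /eqP.
  rewrite mulf_eq0 (negPf (char0_natr_neq0 char0 (psum_count_gt0 pm))) orbF.
  by rewrite mcoeff_eq0 la.
move=> l' /andP[l'l l'a]; rewrite [LHS](_ : _ = a@_l' * psym_part K l' m) //.
rewrite coef_prod_psym //.
case: (posnP (psum_count (l' : intpart) m)) => [->|]; first by rewrite mulr0.
move=> /(psum_count_coarser (l0P l'))[le_l eq_l].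
have sz : size (exponents m) = size (l' : intpart).
  by apply/eqP; rewrite eqn_leq le_l (perm_size pm) maxl.
case/eqP: l'l; apply: val_inj.
apply: (sorted_eq (leT := geq)).
- by move=> x y z /= yx zy; apply: leq_trans zy yx.
- by move=> x y; rewrite andbC => /anti_leq.
- by case/andP: (valP l').
- by case/andP: (valP l).
by rewrite -(permPr pm) perm_sym eq_l.
Qed.

End PowerSums.

(** * Noncommutative power sums *)

Section NSymTheory.
Variable K : fieldType.
Hypothesis char0 : [pchar K] =i pred0.

Lemma malgC_comm (x : K) (f : nsym K) : f * x%:MP = x *: f.
Proof.
rewrite (malgMEw (fsubset_refl _) (msuppC_le _)).
rewrite [in RHS](monalgE f) scaler_sumr.
apply: eq_bigr => w _; rewrite big_seq_fset1 mcoeffC eqxx mulm1.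
by apply/malgP => w1; rewrite mcoeffZ !mcoeffU mulrC mulr1n mulrnAr.
Qed.

Lemma nsym_scalerAr (x : K) (f g : nsym K) : f * (x *: g) = x *: (f * g).
Proof. by rewrite -!malgC_comm mulrA. Qed.

Lemma nsym_prodZ (b : nat -> K) (u : nat -> nsym K) (s : seq nat) :
  \prod_(k <- s) (b k *: u k) = (\prod_(k <- s) b k) *: \prod_(k <- s) u k.
Proof.
elim: s => [|k s IHs]; first by rewrite !big_nil scale1r.
by rewrite !big_cons IHs -scalerAl nsym_scalerAr scalerA.
Qed.

Lemma newton_Psi : newton (Sgen K) (Psi K).
Proof. exact: Psi_rec. Qed.

(** The letter i stands for S_(i + 1), whence the predecessors. *)
Lemma prod_Sgen (a : seq nat) : 0%N \notin a ->
  \prod_(k <- a) Sgen K k = << FMonom (map predn a) >>.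
Proof.
elim: a => [|k a IHa].
  by rewrite big_nil -fmoneE.
rewrite inE negb_or eq_sym -lt0n => /andP[k0 /IHa IH].
rewrite big_cons IH; case: k k0 => //= k _; rewrite malgM_def fgmulUU mulr1.
by congr << _ >>; apply/eqP; rewrite fmP fmM fmuE.
Qed.

Definition subst_word (w : {fmonom nat}) : nsym K :=
  \prod_(i <- (w : seq nat)) comp_sum (Sgen K) i.+1.

Fact subst_word_morph : mmorphism subst_word.
Proof.
by split=> [x y|]; rewrite /subst_word ?fmM ?fm1 ?big_cat ?big_nil.
Qed.

HB.instance Definition _ :=
  isMultiplicative.Build {fmonom nat} (nsym K) subst_word subst_word_morph.

(** The algebra endomorphism inverse to S_k |-> Psi_k: it sends S_n to the
    solution of the recursion with u = S. *)
Definition subst_nsym (f : nsym K) : nsym K := mmap (@malgC {fmonom nat} K) subst_word f.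

Fact subst_nsym_mul : multiplicative subst_nsym.
Proof.
apply: commr_mmap_is_multiplicative => g m m'.
by rewrite /GRing.comm malgC_comm mul_malgC.
Qed.

Lemma subst_nsymB : {morph subst_nsym : f g / f - g}.
Proof. exact: mmap_is_additive. Qed.

HB.instance Definition _ :=
  GRing.isAdditive.Build (nsym K) (nsym K) subst_nsym subst_nsymB.
HB.instance Definition _ :=
  GRing.isMultiplicative.Build (nsym K) (nsym K) subst_nsym subst_nsym_mul.

Lemma subst_nsymZ (x : K) f : subst_nsym (x *: f) = x *: subst_nsym f.
Proof. by rewrite /subst_nsym mmapZ mul_malgC. Qed.

Lemma subst_Sgen n : subst_nsym (Sgen K n) = comp_sum (Sgen K) n.
Proof.
case: n => [|n]; first by rewrite comp_sum0 rmorph1.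
by rewrite /subst_nsym mmapU /= mul1r /subst_word fmU big_seq1.
Qed.

(** The images of the Psi_k and the S_k both solve the recursion for the same
    sequence, and that sequence determines u. *)
Lemma subst_Psi k : (0 < k)%N -> subst_nsym (Psi K k) = Sgen K k.
Proof.
apply: (newton_inj (y := comp_sum (Sgen K))
          (u := fun k => subst_nsym (Psi K k)) (u' := Sgen K)).
- exact: comp_sum0.
- move=> n n0; rewrite -subst_Sgen -subst_nsymZ Psi_rec // rmorph_sum.
  by apply: eq_bigr => i _; rewrite rmorphM /= subst_Sgen.
- exact: newton_comp_sum.
Qed.

(** The products Psi^a are sent to distinct words, which are linearly
    independent. *)
Lemma Psi_comp_indep : lin_independent (Psi_comp K).
Proof.
move=> a a0; apply/malgP => i; rewrite mcoeff0.
pose word (b : composition) := FMonom (map predn b).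
have wP j : subst_nsym (Psi_comp K j) = << word j >>.
  rewrite rmorph_prod -prod_Sgen ?(valP j) //; apply: eq_big_seq => k kj.
  exact: subst_Psi (composition_gt0 kj).
have : (subst_nsym (lincomb (Psi_comp K) a))@_(word i) = 0.
  by rewrite a0 rmorph0 mcoeff0.
rewrite (lincombEw _ (fsubsetU1 i (msupp a))) rmorph_sum raddf_sum /=.
rewrite (bigD1_seq i) ?fset_uniq ?fset1U1 //= big1 => [|j ji].
  by rewrite subst_nsymZ wP mcoeffZ mcoeffU1 eqxx mulr1 addr0.
rewrite subst_nsymZ wP mcoeffZ mcoeffU1 fmP /word /=.
case: eqP => [e|]; last by rewrite mulr0.
case/eqP: ji; apply/val_inj.
have predK (b : composition) : map succn (map predn b) = b.
  rewrite -map_comp -[RHS]map_id; apply/eq_in_map => k kb /=.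
  by rewrite prednK // (composition_gt0 kb).
by rewrite -[LHS]predK e predK.
Qed.

Lemma Sgen_comp_sum n : Sgen K n = comp_sum (Psi K) n.
Proof.
apply: (newton_uniq char0) newton_Psi (newton_comp_sum char0 _) n.
by rewrite comp_sum0.
Qed.

End NSymTheory.

(** * The two expansions and their coefficients *)

Section Coefficients.
Variables (K : fieldType).
Hypothesis char0 : [pchar K] =i pred0.
Variable c : nat -> nat.
Local Notation b := (bcoef K c).

Lemma comp_weight_bcoef (a : seq nat) :
  comp_weight K a * \prod_(k <- a) b k =
  \prod_(j < size a) (b (nth 0%N a j) / (sumn (take j.+1 a))%:R).
Proof.
by rewrite mulrC (big_nth 0%N) big_mkord -big_split.
Qed.

(** Appending a part k to a composition with sum s multiplies the count by
    'C(s + k - 1, k - 1) c_k = (s + k - 1)! / s! * b_k, that is, by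
    (s + k)! / s! * b_k / (s + k). *)
Lemma struct_count_weight (a : seq nat) : 0%N \notin a ->
  (\prod_(j < size a) ('C((sumn (take j.+1 a)).-1, (nth 0%N a j).-1) *
                       c (nth 0%N a j)))%:R =
  ((sumn a)`!)%:R * (comp_weight K a * \prod_(k <- a) b k).
Proof.
elim/last_ind: a => [|a k IHa].
  by rewrite /comp_weight !big_ord0 big_nil !mulr1.
rewrite mem_rcons inE negb_or eq_sym -lt0n => /andP[k0 /IHa {}IHa].
rewrite (big_partial_sums_rcons _ (fun s i => 'C(s.-1, i.-1) * c i)%N) /=.
rewrite natrM IHa comp_weight_rcons big_rcons sumn_rcons /=.
case: k k0 => // k _; set s := sumn a; rewrite addnS /= factS !natrM.
have -> : ((s + k)`!)%:R = ('C(s + k, k) * (k`! * s`!))%:R :> K.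
  by rewrite -(bin_fact (leq_addl s k)) addnK.
have n0 : (s + k).+1%:R != 0 :> K by apply: (char0_natr_neq0 char0).
have k0 : (k`!)%:R != 0 :> K by rewrite (char0_natr_neq0 char0) ?fact_gt0.
rewrite /bcoef /= !natrM.
by field; rewrite k0 -natrD addrC natr1 n0.
Qed.

End Coefficients.

Section Sorting.

Fact sort_composition_subproof (a : composition) :
  (0%N \notin sort geq a) && sorted geq (sort geq a).
Proof.
rewrite mem_sort (valP a) sort_sorted // => x y /=.
exact: leq_total.
Qed.

Definition sort_composition (a : composition) : intpart :=
  exist _ (sort geq a) (sort_composition_subproof a).

Lemma sort_composition_eq (a : composition) (l : intpart) :
  (sort_composition a == l) = perm_eq a l.
Proof.
rewrite -val_eqE /intpart_seq /=; apply/eqP/idP => [<-|al].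
  by rewrite perm_sym perm_sort.
case/andP: (valP l) => _ sl.
apply: (sorted_eq (leT := geq)) => //.
- by move=> x y z /= yx zy; apply: leq_trans zy yx.
- by move=> x y; rewrite andbC => /anti_leq.
- by apply: sort_sorted => x y; apply: leq_total.
by rewrite perm_sort.
Qed.

End Sorting.

Section Main.
Variables (K : fieldType).
Hypothesis char0 : [pchar K] =i pred0.
Variable c : nat -> nat.
Local Notation b := (bcoef K c).

(** Apply phi to the expansion of S_n in the Psi^a; each factor Psi_k picks up
    a scalar b_k. *)
Lemma phi_Sgen (phi : {lrmorphism nsym K -> nsym K}) n :
  (forall k, (0 < k)%N -> phi (Psi K k) = b k *: Psi K k) ->
  phi (Sgen K n) = \sum_(a <- compositions n)
    (comp_weight K a * \prod_(k <- (a : seq nat)) b k) *: Psi_comp K a.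
Proof.
move=> phiPsi; rewrite Sgen_comp_sum // rmorph_sum /=; apply: eq_bigr => a _.
rewrite linearZ_LR rmorph_prod /= -scalerA -nsym_prodZ; congr (_ *: _).
by apply: eq_big_seq => k /composition_gt0/phiPsi.
Qed.

Lemma hsym0 : hsym K 0 = 1.
Proof. by apply/val_inj/mseriesP => m /=; rewrite mdeg_eq0. Qed.

(** The images under chi of the recursion for S are Newton's identities, and
    the h_n determine the p_k in them. *)
Lemma chi_Psi (chi : {lrmorphism nsym K -> symfun K}) k :
  (forall k, (0 < k)%N -> chi (Sgen K k) = hsym K k) ->
  (0 < k)%N -> chi (Psi K k) = psym K k.
Proof.
move=> chiS; apply: (newton_inj (y := hsym K) (u := fun k => chi (Psi K k))).
- exact: hsym0.
- move=> n n0; rewrite -chiS // -linearZ Psi_rec // rmorph_sum.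
  apply: eq_big_nat => i _; rewrite rmorphM /=; congr (_ * _).
  by have [->|/chiS//] := posnP (n - i); rewrite rmorph1 hsym0.
exact: newton_hsym.
Qed.

(** Both sides solve the recursion with u_k = b_k p_k. *)
Lemma chi_phi_Sgen (R : nat -> symfun K) (phi : {lrmorphism nsym K -> nsym K})
    (chi : {lrmorphism nsym K -> symfun K}) n :
  sprout_sequence (seed K c) R ->
  (forall k, (0 < k)%N -> phi (Psi K k) = b k *: Psi K k) ->
  (forall k, (0 < k)%N -> chi (Sgen K k) = hsym K k) ->
  chi (phi (Sgen K n)) = R n.
Proof.
move=> sproutR phiPsi chiS.
have RE := sprout_sequence_coef (seed0 K c) sproutR.
apply: (newton_uniq char0 (y := fun n => chi (phi (Sgen K n)))
          (u := fun k => b k *: psym K k)).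
- rewrite /= !rmorph1 -hsym0; apply/val_inj/mseriesP => m /=.
  rewrite RE /sprout_coef; case: eqP => [m0|]; last by rewrite mul0r.
  rewrite mul1r big_seq big1 // => i; rewrite -cmE_neq0 -lt0n.
  by have := leq_mdeg m i; rewrite m0 leqn0 => /eqP->.
- move=> d d0; rewrite -!linearZ Psi_rec // !rmorph_sum.
  apply: eq_big_nat => i /andP[i0 _].
  by rewrite !rmorphM /= phiPsi // linearZ /= chi_Psi.
exact: newton_sprout (seed0 K c) _ _ (seed_rec char0 c) RE.
Qed.

End Main.

Theorem proposition6p1 (K : fieldType) (char0 : [pchar K] =i pred0)
    (c : nat -> nat) (C : nat -> finType)
    (cardC : forall k : nat, (0 < k)%N -> #|C k| = c k)
    (R : nat -> symfun K) (sproutR : sprout_sequence (seed K c) R)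
    (phi : {lrmorphism nsym K -> nsym K})
    (phiPsi : forall k : nat, (0 < k)%N -> phi (Psi K k) = bcoef K c k *: Psi K k)
    (chi : {lrmorphism nsym K -> symfun K})
    (chiS : forall k : nat, (0 < k)%N -> chi (Sgen K k) = hsym K k)
    (n : nat) :
  [/\ forall a : composition, sumn a = n ->
        let s (j : nat) := sumn (take j.+1 a) in
        [/\ num_max_ordered C n a =
              (\prod_(j < size a) ('C((s j).-1, (nth 0 a j).-1) * c (nth 0 a j)))%N,
            (num_max_ordered C n a)%:R =
              (n`!)%:R * \prod_(j < size a) (bcoef K c (nth 0%N a j) / (s j)%:R) &
            (num_max_ordered C n a)%:R =
              (n`!)%:R * basis_coef (Psi_comp K) a (phi (Sgen K n))],
      (n`!)%:R *: phi (Sgen K n) =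
        \sum_(a <- compositions n) (num_max_ordered C n a)%:R *: Psi_comp K a,
      chi ((n`!)%:R *: phi (Sgen K n)) = (n`!)%:R *: R n &
      forall l : intpart, sumn l = n ->
        (n`!)%:R * basis_coef (@psym_part K) l (R n) = (num_block_sizes C n l)%:R].
Proof.
pose w (a : composition) := comp_weight K a * \prod_(k <- (a : seq nat)) bcoef K c k.
have numE (a : composition) : sumn a = n ->
    (num_max_ordered C n a)%:R = (n`!)%:R * w a.
  move=> sa; rewrite (num_max_orderedE cardC (valP a) sa).
  by rewrite struct_count_weight ?(valP a) // sa.
have phiE := phi_Sgen char0 n phiPsi.
split.
- move=> a sa s; split; first exact: (num_max_orderedE cardC (valP a) sa).
    by rewrite numE // /w comp_weight_bcoef.
  rewrite phiE (basis_coef_sum (v := Psi_comp K) _ _ id) ?numE //; last first.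
    exact: Psi_comp_indep.
  congr (_ * _); rewrite (bigD1_seq a) ?compositions_uniq ?mem_compositions ?sa //=.
  by rewrite eqxx [X in _ + X]big1 ?addr0 // => a' /negPf->.
- rewrite phiE scaler_sumr; apply: eq_big_seq => a.
  by rewrite mem_compositions => /eqP sa; rewrite scalerA numE.
- by rewrite linearZ /= (chi_phi_Sgen char0 n sproutR phiPsi chiS).
move=> l sl; rewrite -(chi_phi_Sgen char0 n sproutR phiPsi chiS) phiE.
rewrite rmorph_sum /= (eq_bigr (fun a => w a *: psym_part K (sort_composition a))).
  rewrite basis_coef_sum; last exact: psym_part_indep.
  rewrite (num_block_sizesE C sl) natr_sum mulr_sumr [RHS]big_mkcond /=.
  apply: eq_big_seq => a; rewrite mem_compositions => /eqP sa.
  rewrite sort_composition_eq; case: ifP => _; last by rewrite mulr0.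
  by rewrite numE // mulr1n.
move=> a _; rewrite linearZ /= rmorph_prod; congr (_ *: _).
rewrite /psym_part [RHS](perm_big a) ?perm_sort //=.
by apply: eq_big_seq => k /composition_gt0; apply: chi_Psi.
Qed.
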